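(* The discrete Heisenberg group $\mathsf{H}_3(\mathbb{Z})$ admits a non-empty strongly aperiodic shift of finite type $\Omega$ together with a factor map $\phi:\Omega\to\phi(\Omega)$ onto a subshift $\phi(\Omega)$ (over some finite alphabet) such that: (i) $\phi(\Omega)$ is strongly aperiodic and minimal (and hence is a strongly aperiodic, minimal sofic $\mathsf{H}_3(\mathbb{Z})$-shift); (ii) $\phi$ is at most two-to-one, i.e. every configuration in $\phi(\Omega)$ has at most two preimages under $\phi$; (iii) $\phi$ is one-to-one on a dense set of configurations, i.e. there is a dense subset $D\subseteq\phi(\Omega)$ such that every $\omega\in D$ has exactly one preimage.
   Context: The discrete Heisenberg group $\mathsf{H}_3(\mathbb{Z})$ is the group of $3\times 3$ upper-triangular unipotent integer matrices $\begin{pmatrix}1&x&z\\0&1&y\\0&0&1\end{pmatrix}$, $x,y,z\in\mathbb{Z}$, under matrix multiplication; equivalently the semidirect product $\mathbb{Z}^2\rtimes_A\mathbb{Z}$ with $A=\begin{pmatrix}1&0\\1&1\end{pmatrix}$, with operation $(x,(y,z))\cdot(a,(b,c))=(x+a,(y+b,z+c+xb))$. For a finitely generated group $G$ and finite alphabet $\mathcal{A}$, the full shift is $\mathcal{A}^G$ with the prodiscrete (product) topology and the right shift action $(\sigma^g\omega)_h=\omega_{hg}$. A subshift is a non-empty closed shift-invariant subset $\Omega\subseteq\mathcal{A}^G$. A pattern is a map $p:F\to\mathcal{A}$ with $F\subseteq G$ finite; $p$ occurs in $\omega$ if $\omega|_{Fg}$ equals $p$ translated, for some $g\in G$. A shift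 of finite type (SFT) is a set of the form $\{\omega\in\mathcal{A}^G: \text{no } p\in\mathcal{F}\text{ occurs in }\omega\}$ for a finite set $\mathcal{F}$ of patterns. A factor map between subshifts is a continuous surjective map commuting with the shift actions; a sofic shift is a factor of an SFT. The stabilizer of $\omega$ is $\mathrm{Stab}(\omega)=\{g\in G:\sigma^g\omega=\omega\}$; a subshift is strongly aperiodic if every configuration in it has trivial stabilizer. A subshift is minimal if it contains no non-empty proper closed shift-invariant subset (equivalently, every orbit is dense). *)

(* Defs.v *)
From Stdlib Require Import ZArith List.
From mathcomp Require Import ssreflect ssrfun ssrbool eqtype fintype.
Set Implicit Arguments.
Unset Strict Implicit.
Unset Printing Implicit Defensive.
Import ListNotations.
Open Scope Z_scope.

(** The discrete Heisenberg group H_3(Z): the triple (x, y, z) stands for the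
    matrix [[1,x,z],[0,1,y],[0,0,1]]; the product is matrix multiplication,
    i.e. (x,(y,z)).(a,(b,c)) = (x+a,(y+b, z+c+x*b)). *)
Definition H3 : Type := (Z * Z * Z)%type.
Definition h3_mul (g h : H3) : H3 :=
  let '(x, y, z) := g in let '(a, b, c) := h in
  (x + a, y + b, z + c + x * b).
Definition h3_one : H3 := (0, 0, 0).

Definition config (A : Type) := H3 -> A.
Definition shift {A : Type} (g : H3) (w : config A) : config A :=
  fun h => w (h3_mul h g).

Definition cfg_eq {A : Type} (w w' : config A) : Prop := forall h, w h = w' h.

Definition agree_on {A : Type} (F : list H3) (w w' : config A) : Prop :=
  forall h, In h F -> w h = w' h.

Definition cset (A : Type) := config A -> Prop.

(** Closed in the prodiscrete topology: contains every configuration all of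
    whose finite windows are approximated by elements of the set. *)
Definition closed_set {A : Type} (X : cset A) : Prop :=
  forall w, (forall F : list H3, exists w', X w' /\ agree_on F w w') -> X w.

Definition shift_invariant {A : Type} (X : cset A) : Prop :=
  forall g w, X w -> X (shift g w).

Definition nonempty {A : Type} (X : cset A) : Prop := exists w, X w.

Definition subshift {A : Type} (X : cset A) : Prop :=
  nonempty X /\ closed_set X /\ shift_invariant X.

Definition dense_in {A : Type} (D X : cset A) : Prop :=
  (forall w, D w -> X w) /\
  forall w F, X w -> exists d, D d /\ agree_on F w d.

(** Patterns: finite partial maps H3 -> A given as lists of (position, letter).
    p occurs in w at g when w (h g) = p(h) for all h in the support. *)
Definition pattern (A : Type) := list (H3 * A).
Definition occurs_at {A : Type} (p : pattern A) (w : config A) (g : H3) : Prop :=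
  forall h a, In (h, a) p -> w (h3_mul h g) = a.
Definition occurs {A : Type} (p : pattern A) (w : config A) : Prop :=
  exists g, occurs_at p w g.

Definition SFT_of {A : Type} (Fb : list (pattern A)) : cset A :=
  fun w => forall p, In p Fb -> ~ occurs p w.
Definition is_SFT {A : Type} (X : cset A) : Prop :=
  exists Fb : list (pattern A), forall w, X w <-> SFT_of Fb w.

Definition strongly_aperiodic {A : Type} (X : cset A) : Prop :=
  forall w g, X w -> cfg_eq (shift g w) w -> g = h3_one.

Definition minimal {A : Type} (X : cset A) : Prop :=
  forall Y : cset A, (forall w, Y w -> X w) -> nonempty Y -> closed_set Y ->
    shift_invariant Y -> forall w, X w -> Y w.

Definition img_set {A B : Type} (phi : config A -> config B) (X : cset A) : cset B :=
  fun y => exists w, X w /\ cfg_eq (phi w) y.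

Definition continuous_on {A B : Type} (phi : config A -> config B) (X : cset A)
  : Prop :=
  forall w (F : list H3), X w -> exists E : list H3,
    forall w', X w' -> agree_on E w w' -> agree_on F (phi w) (phi w').

Definition equivariant_on {A B : Type} (phi : config A -> config B) (X : cset A)
  : Prop :=
  forall g w, X w -> cfg_eq (phi (shift g w)) (shift g (phi w)).

(** phi is a factor map from X onto its image: continuous and shift-commuting
    on X, and (as a map into phi(X)) automatically surjective. *)
Definition factor_map_on {A B : Type} (phi : config A -> config B) (X : cset A)
  : Prop := continuous_on phi X /\ equivariant_on phi X.

Definition at_most_two_to_one {A B : Type} (phi : config A -> config B)
  (X : cset A) : Prop :=
  forall y w1 w2 w3, X w1 -> X w2 -> X w3 ->
    cfg_eq (phi w1) y -> cfg_eq (phi w2) y -> cfg_eq (phi w3) y ->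
    cfg_eq w1 w2 \/ cfg_eq w1 w3 \/ cfg_eq w2 w3.

Definition unique_preimage {A B : Type} (phi : config A -> config B)
  (X : cset A) (y : config B) : Prop :=
  exists w, X w /\ cfg_eq (phi w) y /\
    forall w', X w' -> cfg_eq (phi w') y -> cfg_eq w' w.

(* Main.v *)
Require Import Defs.
From mathcomp Require Import ssreflect ssrfun ssrbool eqtype seq fintype.
From Stdlib Require Import ZArith Lia List Classical FunctionalExtensionality
  PropExtensionality.
Require Import Defs.
Set Implicit Arguments.
Unset Strict Implicit.
Unset Printing Implicit Defensive.
Open Scope Z_scope.

(** We construct an SFT that is itself minimal, so that the factor map can be the
    identity.  Give the plane [x = const] (a coset of <Y, Z>) the level v_2(x) and
    the plane [y = const] (a coset of <X, Z>) the level v_2(y).  A plane of level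
    [l] carries clocks that display the other horizontal coordinate in units of
    [2^l] and the central coordinate in units of [4^l]; local rules make the clocks
    constant or advancing along the plane, and at the Z-line where two planes cross
    the two sets of clocks are compared.  The comparison makes the clocks of the
    odd planes read coordinates modulo 4, and the even planes satisfy the same rules
    after rescaling by the endomorphism (x, y, z) -> (2x, 2y, 4z).  So every
    configuration desubstitutes, uniquely, into another one.  A period is divisible
    by this endomorphism infinitely often, hence trivial.  A single tile of the
    k-fold desubstitution determines the configuration on a ball of radius about
    2^k, and every admissible tile occurs in every configuration: this gives
    minimality. *)

Ltac Zify.zify_post_hook ::= Z.to_euclidean_division_equations.

(** * Tiles and local rules *)

Definition quarter : Type := (bool * bool)%type.
Definition qval (q : quarter) : Z := 2 * Z.b2z q.1 + Z.b2z q.2.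
Definition qof (n : Z) : quarter := (Z.odd (n / 2), Z.odd n).

Lemma b2z_odd n : Z.b2z (Z.odd n) = n mod 2.
Proof. by rewrite Zmod_odd; case: Z.odd. Qed.

Lemma qofK n : qval (qof n) = n mod 4.
Proof. rewrite /qval /qof; cbn [fst snd]; rewrite !b2z_odd; lia. Qed.

Lemma qval_inj p q : qval p = qval q -> p = q.
Proof. by case: p => [[] []]; case: q => [[] []]. Qed.

(* A side is [(c, r, q, f, w, h)].  In the ideal configuration the first side of
   the tile at [(x, y, z)], where [2^l] is the exact power of 2 dividing [x], has
   [c = (l = 0)], [r] = binary digit [l + 1] of [x], [q = floor(y / 2^l) mod 4],
   [f = (2^l divides y)], [w = floor(z / 4^l) mod 4] and [h = (4^l divides z)];
   the second side is obtained in the same way from [(y, x, z - x y)]. *)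
Definition side : Type := (bool * bool * quarter * bool * quarter * bool)%type.
Definition tile : Type := (side * side)%type.

Definition sc (s : side) : Z := let '(c, r, q, f, w, h) := s in Z.b2z c.
Definition sr (s : side) : Z := let '(c, r, q, f, w, h) := s in Z.b2z r.
Definition sq (s : side) : Z := let '(c, r, q, f, w, h) := s in qval q.
Definition sf (s : side) : Z := let '(c, r, q, f, w, h) := s in Z.b2z f.
Definition sw (s : side) : Z := let '(c, r, q, f, w, h) := s in qval w.
Definition sh (s : side) : Z := let '(c, r, q, f, w, h) := s in Z.b2z h.

Definition mk (c r q f w h : Z) : side :=
  (Z.odd c, Z.odd r, qof q, Z.odd f, qof w, Z.odd h).

Lemma mkE c r q f w h :
  sc (mk c r q f w h) = c mod 2 /\ sr (mk c r q f w h) = r mod 2 /\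
  sq (mk c r q f w h) = q mod 4 /\ sf (mk c r q f w h) = f mod 2 /\
  sw (mk c r q f w h) = w mod 4 /\ sh (mk c r q f w h) = h mod 2.
Proof. by cbn [mk sc sr sq sf sw sh]; rewrite !b2z_odd !qofK. Qed.

Lemma side_bounds s : (0 <= sc s <= 1) /\ (0 <= sr s <= 1) /\ (0 <= sq s <= 3) /\
  (0 <= sf s <= 1) /\ (0 <= sw s <= 3) /\ (0 <= sh s <= 1).
Proof. by case: s => [[[[[[] []] [[] []]] []] [[] []]] []]. Qed.

Lemma side_ext s t : sc s = sc t -> sr s = sr t -> sq s = sq t -> sf s = sf t ->
  sw s = sw t -> sh s = sh t -> s = t.
Proof.
case: s => [[[[[c r] q] f] w] h]; case: t => [[[[[c' r'] q'] f'] w'] h'] /=.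
by move=> /Z.b2z_inj -> /Z.b2z_inj -> /qval_inj -> /Z.b2z_inj -> /qval_inj -> /Z.b2z_inj ->.
Qed.

Lemma side_mk s : s = mk (sc s) (sr s) (sq s) (sf s) (sw s) (sh s).
Proof. by case: s => [[[[[[] []] [[] []]] []] [[] []]] []]. Qed.

(** The clock [q] counts multiples of the unit [2^l], so it advances exactly on entering a tile
    whose flag [f] is set. [stepZ] treats [w] and [h] alike. *)
Definition stepT (s t : side) : Prop :=
  sc t = sc s /\ sr t = sr s /\ sq t = (sq s + sf t) mod 4 /\
  sw t = sw s /\ sh t = sh s.
Definition stepZ (s t : side) : Prop :=
  sc t = sc s /\ sr t = sr s /\ sq t = sq s /\ sf t = sf s /\
  sw t = (sw s + sh t) mod 4.

(* [below s t]: the plane of [s] has strictly smaller level than that of [t];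
   [sq s = 2] means that the levels differ by exactly one. *)
Definition below (s t : side) : Prop :=
  sf s = 1 /\ sf t = 0 /\
  ((sq s = 2 /\ sq t mod 2 = sr s /\ (sh t = 1 <-> sh s = 1 /\ sw s = 2)) \/
   (sq s = 0 /\ (sh t = 1 -> sh s = 1 /\ sw s = 0))).
(** Planes of equal level cross at odd multiples of [2^l], where each clock [q] shows the other
    plane's digit. The change of [w] is the twist [x * y / 4^l], as [(1 + 2r)(1 + 2r')] is
    [1 + 2r + 2r'] modulo 4. *)
Definition level (e : Z) (s t : side) : Prop :=
  sf s = 1 /\ sf t = 1 /\ sq s = 1 + 2 * sr t /\ sq t = 1 + 2 * sr s /\
  sh s = sh t /\ sw t = (sw s - e * (1 + 2 * sr s + 2 * sr t)) mod 4.
(** This anchors the hierarchy: odd planes have unit 1, so their flags are always set, and an odd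
    coordinate is no multiple of the unit of an even plane. *)
Definition parity (s t : side) : Prop :=
  (sc s = 1 -> sf s = 1 /\ sh s = 1) /\ (sc s = 1 -> sc t = 0 -> sf t = 0).
Definition cross (e : Z) (s t : side) : Prop :=
  parity s t /\ parity t s /\ (level e s t \/ below s t \/ below t s).

Definition line := Z -> Z -> Z -> side.
Definition half (P : line) : Prop :=
  (forall x y z y', y' = y + 1 -> stepT (P x y z) (P x y' z)) /\
  (forall x y z z', z' = z + 1 -> stepZ (P x y z) (P x y z')) /\
  (forall x y z, sc (P (x + 1) y z) = 1 - sc (P x y z)).
(* The sign [e] makes the situation symmetric: exchanging the two families of
   planes replaces the commutator by its inverse. *)
Definition twisted (e : Z) (P Q : line) : Prop :=
  (e = 1 \/ e = -1) /\ half P /\ half Q /\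
  forall x y z z', z' = z - e * (x * y) -> cross e (P x y z) (Q y x z').

Ltac bnd s := let bd := fresh "bd" in pose proof (side_bounds s) as bd.

Lemma cross_sym e s t : e = 1 \/ e = -1 -> cross e s t -> cross (- e) t s.
Proof.
bnd s; bnd t.
move=> He [Hp [Hq H]]; split=> //; split=> //.
case: H => [H|[H|H]]; [left|by right; right|by right; left].
unfold level in *; case: He H => -> ?; lia.
Qed.

Lemma twisted_sym e P Q : twisted e P Q -> twisted (- e) Q P.
Proof.
move=> [He [HP [HQ H]]]; split; first lia.
split=> //; split=> // y x z z' Ez; apply: cross_sym => //.
by apply: H; lia.
Qed.

Lemma Z_const (T : Type) (f : Z -> T) : (forall z, f (z + 1) = f z) -> forall z, f z = f 0.
Proof.
move=> H z; have [n [E|E]] : exists n : nat, z = Z.of_nat n \/ z = - Z.of_nat n.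
- by exists (Z.to_nat (Z.abs z)); lia.
- rewrite {}E; elim: n => [|n IH] //; rewrite -IH -[in RHS]H; congr f; lia.
- rewrite {}E; elim: n => [|n IH] //; rewrite -IH -[in LHS]H; congr f; lia.
Qed.

(** Each rule freezes the fields it does not advance, so a value read at one crossing holds along a
    whole line. *)
Lemma line_const P : half P -> forall x y z,
  sc (P x y z) = sc (P x 0 0) /\ sr (P x y z) = sr (P x 0 0) /\
  sq (P x y z) = sq (P x y 0) /\ sf (P x y z) = sf (P x y 0) /\
  sw (P x y z) = sw (P x 0 z) /\ sh (P x y z) = sh (P x 0 z).
Proof.
move=> [HT [HZ _]] x y z.
have Zc : forall y, (sc (P x y z), sr (P x y z), sq (P x y z), sf (P x y z)) =
   (sc (P x y 0), sr (P x y 0), sq (P x y 0), sf (P x y 0)).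
  move=> y1; apply: (@Z_const _ (fun z => (sc (P x y1 z), sr (P x y1 z), sq (P x y1 z), sf (P x y1 z)))) => z1.
  by have [-> [-> [-> [-> _]]]] := HZ x y1 z1 (z1 + 1) erefl.
have Tc : forall z, (sc (P x y z), sr (P x y z), sw (P x y z), sh (P x y z)) =
   (sc (P x 0 z), sr (P x 0 z), sw (P x 0 z), sh (P x 0 z)).
  move=> z1; apply: (@Z_const _ (fun y => (sc (P x y z1), sr (P x y z1), sw (P x y z1), sh (P x y z1)))) => y1.
  by have [-> [-> [_ [-> ->]]]] := HT x y1 z1 (y1 + 1) erefl.
move: (Zc y) (Tc z) (Tc 0) => [? ? ? ?] [? ? ? ?] [? ? _ _].
by repeat split; congruence.
Qed.

(** * Normal position: the odd planes read coordinates modulo 4 *)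

Definition normal (P : line) : Prop :=
  (forall x y z, sc (P x y z) = x mod 2) /\
  forall x y z, x mod 2 = 1 -> P x y z = mk 1 (x / 2) y 1 z 1.

(** The clock of an odd plane of the other family shows [1 + 2 * r] at each odd plane it crosses and
    ticks at every step, so it gains 2 from [x] to [x + 2]. *)
Lemma odd_alternates e P Q x : twisted e P Q -> sc (P x 0 0) = 1 ->
  sr (P (x + 2) 0 0) = 1 - sr (P x 0 0).
Proof.
move=> [He [HP [HQ HC]]] Hx.
have [y Hy] : exists y, sc (Q y 0 0) = 1.
  have := proj2 (proj2 HQ) 0 0 0; bnd (Q 0 0 0); bnd (Q 1 0 0) => E.
  have [?|?] : sc (Q 0 0 0) = 1 \/ sc (Q 1 0 0) = 1 by (rewrite Z.add_0_l in E; lia).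
    by exists 0. by exists 1.
have Hx2 : sc (P (x + 2) 0 0) = 1.
  have := proj2 (proj2 HP) x 0 0; have := proj2 (proj2 HP) (x+1) 0 0.
  have -> : x + 1 + 1 = x + 2 by lia.
  lia.
have K : forall x', sc (P x' 0 0) = 1 -> sq (Q y x' 0) = 1 + 2 * sr (P x' 0 0).
  move=> x' Hx'.
  have := HC x' y (e * (x' * y)) 0 ltac:(lia).
  have := line_const HP x' y (e * (x' * y)); have := line_const HQ y x' 0.
  bnd (P x' y (e * (x' * y))); bnd (Q y x' 0).
  rewrite /cross /parity /level /below; lia.
have F : forall x', sf (Q y x' 0) = 1.
  move=> x'; have := HC x' y (e * (x' * y)) 0 ltac:(lia).
  have := line_const HQ y x' 0.
  rewrite /cross /parity; lia.
have := K x Hx; have := K _ Hx2; have := F (x+1); have := F (x+2).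
have := proj1 HQ y x 0 (x+1) erefl. have := proj1 HQ y (x+1) 0 (x+2) ltac:(lia).
bnd (P x 0 0); bnd (P (x+2) 0 0).
rewrite /stepT; lia.
Qed.

Lemma normal_origin e P Q : twisted e P Q -> exists i,
  sc (P i 0 0) = 0 /\ sr (P (i + 1) 0 0) = 0.
Proof.
move=> HT.
have HP : half P by case: HT => _ [].
have Hc x := proj2 (proj2 HP) x 0 0.
have [i Hi] : exists i, sc (P i 0 0) = 0.
  have := Hc 0; bnd (P 0 0 0); bnd (P 1 0 0) => E.
  have [?|?] : sc (P 0 0 0) = 0 \/ sc (P 1 0 0) = 0 by (rewrite Z.add_0_l in E; lia).
    by exists 0. by exists 1.
have := Hc i; have := Hc (i + 1); have := Hc (i + 1 + 1).
have := @odd_alternates _ _ _ (i+1) HT.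
bnd (P (i + 1) 0 0).
have [?|?] : sr (P (i + 1) 0 0) = 0 \/ sr (P (i + 1) 0 0) = 1 by lia.
  by exists i.
move=> A B C E; exists (i + 2).
have -> : i + 2 + 1 = i + 1 + 2 by lia.
have E2 : i + 2 = i + 1 + 1 by lia.
rewrite E2; lia.
Qed.

(** Plane 1 of the second family is a ruler: its clock gives [x], and crossings transfer the
    readings to the odd planes of [P]. Equality of the two central clocks lets one central
    translation normalise both families. *)
Lemma normal_half_aux e P Q : twisted e P Q -> sc (P 0 0 0) = 0 -> sc (Q 0 0 0) = 0 ->
  sr (P 1 0 0) = 0 -> sr (Q 1 0 0) = 0 ->
  sw (Q 1 0 0) = sw (P 1 0 0) /\ (sw (P 1 0 0) = 0 -> normal P).
Proof.
move=> HT cP cQ rP rQ; have [He [HP [HQ HC]]] := HT.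
have cE : forall R : line, half R -> sc (R 0 0 0) = 0 -> forall x, sc (R x 0 0) = x mod 2.
  move=> R [_ [_ HR]] R0 x.
  have := @Z_const _ (fun x => (sc (R x 0 0) - x) mod 2); rewrite /= R0 => K.
  have := K (fun z => ltac:(have := HR z 0 0; lia)) x; bnd (R x 0 0); lia.
have cPx := cE P HP cP; have cQx := cE Q HQ cQ.
have fP : forall x y z, x mod 2 = 1 -> sf (P x y z) = 1 /\ sh (P x y z) = 1.
  move=> x y z Hx; have := HC x y z _ erefl; have := line_const HP x y z; have := cPx x.
  rewrite /cross /parity; lia.
have fQ : forall x y z, x mod 2 = 1 -> sf (Q x y z) = 1 /\ sh (Q x y z) = 1.
  move=> x y z Hx; have := HC y x (z + e * (y * x)) z ltac:(lia).
  have := line_const HQ x y z; have := cQx x.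
  rewrite /cross /parity; lia.
have crs : forall x y z z', z' = z - e * (x * y) -> x mod 2 = 1 -> y mod 2 = 1 ->
    level e (P x y z) (Q y x z').
  move=> x y z z' Ez Hx Hy; have := fP x y z Hx; have := fQ y x z' Hy.
  by have [_ [_ [//|[]]]] := HC x y z z' Ez; rewrite /below; lia.
have qlin : forall R : line, half R -> (forall y z, sf (R 1 y z) = 1) -> 
   forall y, sq (R 1 y 0) = (sq (R 1 0 0) + y) mod 4.
  move=> R [HR _] Rf y.
  have := @Z_const _ (fun y => (sq (R 1 y 0) - y) mod 4) => K.
  have := K (fun y => ltac:(have := HR 1 y 0 _ erefl; have := Rf (y+1) 0; rewrite /stepT; lia)) y.
  bnd (R 1 y 0); rewrite /=; lia.
have wlin : forall (R : line) x, half R -> (forall y z, sh (R x y z) = 1) -> 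
   forall z, sw (R x 0 z) = (sw (R x 0 0) + z) mod 4.
  move=> R x [_ [HR _]] Rf z.
  have := @Z_const _ (fun z => (sw (R x 0 z) - z) mod 4) => K.
  have := K (fun z => ltac:(have := HR x 0 z _ erefl; have := Rf 0 (z+1); rewrite /stepZ; lia)) z.
  bnd (R x 0 z); rewrite /=; lia.
have qP1 := qlin P HP (fun y z => proj1 (fP 1 y z erefl)).
have qQ1 := qlin Q HQ (fun y z => proj1 (fQ 1 y z erefl)).
have W1 : sw (Q 1 0 0) = sw (P 1 0 0).
  have := crs 1 1 e 0 ltac:(lia) erefl erefl.
  have := line_const HP 1 1 e; have := line_const HQ 1 1 0.
  have := wlin P 1 HP (fun y z => proj2 (fP 1 y z erefl)) e.
  bnd (P 1 0 0); bnd (Q 1 0 0).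
  rewrite /level; case: He => ->; lia.
split=> // W0.
have qQx : forall x, sq (Q 1 x 0) = x mod 4.
  move=> x; have := qQ1 x.
  have := crs 1 1 e 0 ltac:(lia) erefl erefl; have := qQ1 1.
  have := line_const HP 1 1 e; have := line_const HQ 1 1 0; rewrite /level; lia.
have rPx : forall x, x mod 2 = 1 -> sr (P x 0 0) = (x / 2) mod 2.
  move=> x Hx; have := crs x 1 (e * x) 0 ltac:(lia) Hx erefl.
  have := line_const HP x 1 (e * x); have := line_const HQ 1 x 0; have := qQx x.
  rewrite /level; lia.
have qPx : forall x y, x mod 2 = 1 -> sq (P x y 0) = y mod 4.
  move=> x y Hx.
  have := @Z_const _ (fun y => (sq (P x y 0) - y) mod 4) => K.
  have := K (fun y => ltac:(have := proj1 HP x y 0 _ erefl; have := fP x (y+1) 0 Hx; rewrite /stepT; lia)) y.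
  have := K (fun y => ltac:(have := proj1 HP x y 0 _ erefl; have := fP x (y+1) 0 Hx; rewrite /stepT; lia)) 1.
  have := crs x 1 (e * x) 0 ltac:(lia) Hx erefl.
  have := line_const HP x 1 (e * x); have := line_const HQ 1 x 0; have := line_const HQ 1 0 0.
  bnd (P x y 0); bnd (P x 1 0); rewrite /level; lia.
split=> [x y z|x y z Hx]; first by have := line_const HP x y z; have := cPx x; lia.
have := line_const HP x y z; have := mkE 1 (x/2) y 1 z 1 => M L.
have Lw := wlin P x HP (fun y z => proj2 (fP x y z Hx)).
(* At the crossing with plane 1 the twist [e * (1 + 2 * r)] cancels the height [e * x] modulo 4. *)
have Wx : sw (P x 0 0) = 0.
  have := crs x 1 (e * x) 0 ltac:(lia) Hx erefl.
  have := line_const HP x 1 (e * x); have := line_const HQ 1 x 0; have := Lw (e * x).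
  have := rPx x Hx; bnd (P x 0 0); rewrite /level; case: He => ->; lia.
have := fP x y z Hx; have := rPx x Hx; have := qPx x y Hx; have := cPx x; have := Lw z => *.
apply: side_ext; lia.
Qed.

Lemma normal_halves e P Q : twisted e P Q -> sc (P 0 0 0) = 0 -> sc (Q 0 0 0) = 0 ->
  sr (P 1 0 0) = 0 -> sr (Q 1 0 0) = 0 -> sw (P 1 0 0) = 0 -> normal P /\ normal Q.
Proof.
move=> HT cP cQ rP rQ wP.
have [E HP] := normal_half_aux HT cP cQ rP rQ.
have [_ HQ] := normal_half_aux (twisted_sym HT) cQ cP rQ rP.
by split; [apply: HP|apply: HQ; rewrite E].
Qed.

(** * Desubstitution of one family of planes *)

Lemma normal_odd P x y z : normal P -> x mod 2 = 1 ->
  sc (P x y z) = 1 /\ sr (P x y z) = (x / 2) mod 2 /\ sq (P x y z) = y mod 4 /\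
  sf (P x y z) = 1 /\ sw (P x y z) = z mod 4 /\ sh (P x y z) = 1.
Proof. by move=> [_ H] Hx; rewrite H //; have := mkE 1 (x / 2) y 1 z 1. Qed.

Lemma even_f e P Q x y z : twisted e P Q -> normal P -> normal Q ->
  x mod 2 = 0 -> y mod 2 = 1 -> sf (P x y z) = 0.
Proof.
move=> [He [HP [HQ HC]]] [NP _] NQ Hx Hy.
have := HC x y z _ erefl; have := NP x y z.
have := normal_odd x (z - e * (x * y)) NQ Hy.
rewrite /cross /parity; lia.
Qed.

(** Plane 1 of the other family lies below; its clocks show [x] and [z - e * x] modulo 4, which the
    rule [below] turns into conditions on [z]. *)
Lemma even_h e P Q x y z : twisted e P Q -> normal P -> normal Q ->
  x mod 2 = 0 -> (z mod 4 <> 0 -> sh (P x y z) = 0) /\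
  (x mod 4 = 2 -> z mod 4 = 0 -> sh (P x y z) = 1).
Proof.
move=> HT NP NQ Hx; have [He [HP [HQ HC]]] := HT.
have F := even_f z HT NP NQ Hx (erefl : 1 mod 2 = 1).
have := HC x 1 z (z - e * x) ltac:(lia).
have := normal_odd x (z - e * x) NQ (erefl : 1 mod 2 = 1).
have := line_const HP x y z; have := line_const HP x 1 z; bnd (P x y z).
rewrite /cross /level /below; case: He => ->; lia.
Qed.

(** The odd planes on both sides of [y] have different digits, and [below] copies these into the
    parity of [q]. So [q] ticks in between, necessarily at [y], since the flag at [y + 1] is 0. *)
Lemma two_f e P Q x y z : twisted e P Q -> normal P -> normal Q ->
  x mod 4 = 2 -> y mod 2 = 0 -> sf (P x y z) = 1.
Proof.
move=> HT NP NQ Hx Hy; have [He [HP [HQ HC]]] := HT.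
have Hx2 : x mod 2 = 0 by lia.
have K : forall y, y mod 2 = 1 -> sq (P x y z) mod 2 = (y / 2) mod 2.
  move=> y' Hy'; have F := even_f z HT NP NQ Hx2 Hy'.
  have := HC x y' z _ erefl.
  have := normal_odd x (z - e * (x * y')) NQ Hy'.
  bnd (P x y' z); rewrite /cross /level /below; lia.
have := K (y - 1) ltac:(lia); have := K (y + 1) ltac:(lia).
have := even_f z HT NP NQ Hx2 (_ : (y + 1) mod 2 = 1).
have := proj1 HP x (y - 1) z y ltac:(lia); have := proj1 HP x y z _ erefl.
bnd (P x y z); bnd (P x (y - 1) z); bnd (P x (y + 1) z).
rewrite /stepT => A B C; have := C ltac:(lia); lia.
Qed.

(** If the flag were 1, the planes would have equal level and the clock of plane [y] would be odd.
    It is unchanged one step further, where the odd plane [x + 1], of digit 0, requires it to be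
    even. *)
Lemma four_f e P Q x y z : twisted e P Q -> normal P -> normal Q ->
  x mod 4 = 0 -> y mod 4 = 2 -> sf (P x y z) = 0.
Proof.
move=> HT NP NQ Hx Hy; have [He [HP [HQ HC]]] := HT.
have HT' := twisted_sym HT.
set z' := z - e * (x * y).
have FQ := @two_f _ _ _ y x z' HT' NQ NP Hy ltac:(lia).
have C1 := HC x y z z' erefl.
have HQx := proj1 HQ y x z' _ erefl.
have FQ1 := @even_f _ _ _ y (x + 1) z' HT' NQ NP ltac:(lia) ltac:(lia).
have C2 := HC (x + 1) y (z' + e * ((x + 1) * y)) z' ltac:(lia).
have := @normal_odd P (x + 1) y (z' + e * ((x + 1) * y)) NP ltac:(lia).
bnd (P x y z); bnd (Q y x z'); bnd (Q y (x + 1) z').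
move: C1 C2 HQx; rewrite /cross /level /below /stepT; lia.
Qed.

Ltac compare_literals := repeat match goal with
  | |- context [Z.ltb ?a ?b] => let v := eval compute in (Z.ltb a b) in change (Z.ltb a b) with v
  | |- context [Z.eqb ?a ?b] => let v := eval compute in (Z.eqb a b) in change (Z.eqb a b) with v
  end; cbv iota.

(** An even plane shows [c = 0] at every level, so the coarse parity is recomputed from the coarse
    coordinate. *)
Definition setc (c : Z) (s : side) : side := mk c (sr s) (sq s) (sf s) (sw s) (sh s).
Definition coarse (P : line) : line :=
  fun x y z => setc x (P (2 * x) (2 * y) (4 * z)).

Lemma setcE c s : sc (setc c s) = c mod 2 /\ sr (setc c s) = sr s /\
  sq (setc c s) = sq s /\ sf (setc c s) = sf s /\ sw (setc c s) = sw s /\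
  sh (setc c s) = sh s.
Proof. rewrite /setc; have := mkE c (sr s) (sq s) (sf s) (sw s) (sh s); bnd s; lia. Qed.

(* [dy] and [dz] are the signed offsets from the coarse vertex: below the vertex
   the clocks have not yet passed it. *)
Definition refine (dy dz : Z) (s : side) : side :=
  mk 0 (sr s) (if dy <? 0 then sq s - sf s else sq s) (if dy =? 0 then sf s else 0)
    (if dz <? 0 then sw s - sh s else sw s) (if dz =? 0 then sh s else 0).

(** Flags vanish strictly between vertices, so a clock moves only on reaching one. The offsets stop
    just short of the neighbouring vertices. *)
Lemma refine_coarse e P Q x y z dy dz : twisted e P Q -> normal P -> normal Q ->
  -1 <= dy <= 1 -> -3 <= dz <= 3 ->
  P (2 * x) (2 * y + dy) (4 * z + dz) = refine dy dz (coarse P x y z).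
Proof.
move=> HT NP NQ Hdy Hdz; have [He [HP [HQ HC]]] := HT.
have Hx : (2 * x) mod 2 = 0 by lia.
have [HS [HZ _]] := HP.
have L := line_const HP (2 * x).
have F dy' (H : dy' = 1 \/ dy' = -1) := @even_f _ _ _ (2*x) (2*y+dy') 0 HT NP NQ Hx ltac:(lia).
have G dz' (H : -3 <= dz' <= 3) := proj1 (@even_h _ _ _ (2*x) 0 (4*z+dz') HT NP NQ Hx).
have Qy : sq (P (2*x) (2*y+dy) 0) =
    (if dy <? 0 then sq (P (2*x) (2*y) 0) - sf (P (2*x) (2*y) 0) else sq (P (2*x) (2*y) 0)) mod 4
  /\ sf (P (2*x) (2*y+dy) 0) = if dy =? 0 then sf (P (2*x) (2*y) 0) else 0.
  bnd (P (2*x) (2*y) 0).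
  have [->|[->|->]] : dy = 0 \/ dy = 1 \/ dy = -1 by lia.
  - rewrite Z.add_0_r; compare_literals; lia.
  - have := HS (2*x) (2*y) 0 _ erefl; have := F 1 (or_introl erefl); rewrite /stepT; compare_literals; lia.
  - have := HS (2*x) (2*y + -1) 0 (2*y) ltac:(lia); have := F (-1) (or_intror erefl).
    bnd (P (2*x) (2*y + -1) 0).
    rewrite /stepT; compare_literals; lia.
have Wz : sw (P (2*x) 0 (4*z+dz)) =
    (if dz <? 0 then sw (P (2*x) 0 (4*z)) - sh (P (2*x) 0 (4*z)) else sw (P (2*x) 0 (4*z))) mod 4
  /\ sh (P (2*x) 0 (4*z+dz)) = if dz =? 0 then sh (P (2*x) 0 (4*z)) else 0.
  clear Qy F L HC HQ HS.
  have {}G dz' : -3 <= dz' <= 3 -> dz' <> 0 -> sh (P (2*x) 0 (4*z+dz')) = 0.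
    by move=> A B; apply: G; lia.
  have S dz' : -3 <= dz' <= 2 -> dz' <> -1 ->
      sw (P (2*x) 0 (4*z+(dz'+1))) = sw (P (2*x) 0 (4*z+dz')).
    move=> A B; have := G (dz'+1) ltac:(lia) ltac:(lia).
    have := HZ (2*x) 0 (4*z+dz') (4*z+(dz'+1)) ltac:(lia).
    bnd (P (2*x) 0 (4*z+dz')); rewrite /stepZ; lia.
  have Z0 : sw (P (2*x) 0 (4*z+ -1)) = (sw (P (2*x) 0 (4*z)) - sh (P (2*x) 0 (4*z))) mod 4.
    have := HZ (2*x) 0 (4*z+ -1) (4*z) ltac:(lia).
    bnd (P (2*x) 0 (4*z+ -1)); rewrite /stepZ; lia.
  have B0 : sw (P (2*x) 0 (4*z)) = sw (P (2*x) 0 (4*z)) mod 4.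
    by rewrite Z.mod_small //; have := side_bounds (P (2*x) 0 (4*z)); lia.
  split; last first.
    case: Z.eqb_spec => [->|N]; first by rewrite Z.add_0_r.
    by apply: G; lia.
  have [->|[->|[->|[->|[->|[->|->]]]]]] : dz = 0 \/ dz = 1 \/ dz = 2 \/ dz = 3 \/
    dz = -1 \/ dz = -2 \/ dz = -3 by lia.
  - by rewrite Z.add_0_r.
  - by rewrite (S 0) // Z.add_0_r.
  - by rewrite (S 1) // (S 0) // Z.add_0_r.
  - by rewrite (S 2) // (S 1) // (S 0) // Z.add_0_r.
  - by [].
  - by rewrite -(S (-2)).
  - by rewrite -(S (-3)) // -(S (-2)).
have [L1 [L2 [L3 [L4 [L5 L6]]]]] := L (2*y+dy) (4*z+dz).
have [M1 [M2 [M3 [M4 [M5 M6]]]]] := L (2*y) (4*z).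
have [N1 [N2 [N3 [N4 [N5 N6]]]]] := setcE x (P (2 * x) (2 * y) (4 * z)).
have C0 := proj1 NP (2*x) (2*y+dy) (4*z+dz).
rewrite /refine /coarse N2 N3 N4 N5 N6 M2 M3 M4 M5 M6.
have bd := side_bounds (P (2*x) 0 0).
have bd1 := side_bounds (P (2*x) (2*y) 0).
have bd2 := side_bounds (P (2*x) 0 (4*z)).
set r := sr _ in bd *; set q := (if dy <? 0 then _ else _) in Qy *.
set w := (if dz <? 0 then _ else _) in Wz *.
have [E1 [E2 [E3 [E4 [E5 E6]]]]] := mkE 0 r q
  (if dy =? 0 then sf (P (2 * x) (2 * y) 0) else 0) w
  (if dz =? 0 then sh (P (2 * x) 0 (4 * z)) else 0).
case: Qy Wz => Q1 Q2 [W1 W2].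
apply: side_ext.
- by rewrite C0 E1 Hx.
- by rewrite E2 L2 Z.mod_small //; lia.
- by rewrite E3 L3 Q1.
- rewrite E4 L4 Q2; case: (dy =? 0) => //; rewrite Z.mod_small //; lia.
- by rewrite E5 L5 W1.
- rewrite E6 L6 W2; case: (dz =? 0) => //; rewrite Z.mod_small //; lia.
Qed.

Lemma coarse_half e P Q : twisted e P Q -> normal P -> normal Q -> half (coarse P).
Proof.
move=> HT NP NQ; have [He [HP [HQ HC]]] := HT.
have [HS [HZ _]] := HP.
split; [|split].
- move=> x y z y' ->; rewrite /coarse.
  have F := @even_f _ _ _ (2*x) (2*y+1) (4*z) HT NP NQ ltac:(lia) ltac:(lia).
  have := HS (2*x) (2*y) (4*z) _ erefl.
  have := HS (2*x) (2*y+1) (4*z) (2*(y+1)) ltac:(lia).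
  have := setcE x (P (2 * x) (2 * y) (4 * z)).
  have := setcE x (P (2 * x) (2 * (y+1)) (4 * z)).
  bnd (P (2 * x) (2 * y) (4 * z)).
  rewrite /stepT; lia.
- move=> x y z z' ->; rewrite /coarse.
  have G dz := proj1 (@even_h _ _ _ (2*x) (2*y) (4*z+dz) HT NP NQ ltac:(lia)).
  have := G 1; have := G 2; have := G 3.
  have := HZ (2*x) (2*y) (4*z) (4*z+1) ltac:(lia).
  have := HZ (2*x) (2*y) (4*z+1) (4*z+2) ltac:(lia).
  have := HZ (2*x) (2*y) (4*z+2) (4*z+3) ltac:(lia).
  have := HZ (2*x) (2*y) (4*z+3) (4*(z+1)) ltac:(lia).
  have := setcE x (P (2 * x) (2 * y) (4 * z)).
  have := setcE x (P (2 * x) (2 * y) (4 * (z+1))).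
  bnd (P (2 * x) (2 * y) (4 * z)).
  rewrite /stepZ; lia.
- move=> x y z; rewrite /coarse.
  have := setcE x (P (2 * x) (2 * y) (4 * z)).
  have := setcE (x+1) (P (2 * (x+1)) (2 * y) (4 * z)); lia.
Qed.

(** A coarse odd plane sits at 2 modulo 4, where [two_f] and [even_h] force the flags; a coarse even
    plane sits at 0 modulo 4, where [four_f] clears its flag. *)
Lemma coarse_parity e P Q x y z : twisted e P Q -> normal P -> normal Q ->
  parity (coarse P x y z) (coarse Q y x (z - e * (x * y))).
Proof.
move=> HT NP NQ; rewrite /coarse.
set s := P _ _ _; set t := Q _ _ _.
have := setcE x s; have := setcE y t => St Ss.
split => [|E1 E2].
  have H1 := @two_f _ _ _ (2*x) (2*y) (4*z) HT NP NQ.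
  have H2 := proj2 (@even_h _ _ _ (2*x) (2*y) (4*z) HT NP NQ ltac:(lia)).
  rewrite -/s in H1 H2; lia.
have := @four_f _ _ _ (2*y) (2*x) (4*(z-e*(x*y))) (twisted_sym HT) NQ NP.
rewrite -/t; lia.
Qed.

(** [level] and [below] do not mention [c], so they carry over directly from the vertices. *)
Lemma coarse_twisted e P Q : twisted e P Q -> normal P -> normal Q ->
  twisted e (coarse P) (coarse Q).
Proof.
move=> HT NP NQ; have HT' := twisted_sym HT; have [He [HP [HQ HC]]] := HT.
split=> //; split; first exact: coarse_half HT NP NQ.
split; first exact: coarse_half HT' NQ NP.
move=> x y z z' Ez.
split; first by rewrite Ez; apply: coarse_parity.
split.
  have -> : z = z' - (- e) * (y * x) by lia.
  exact: coarse_parity.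
have [_ [_]] := HC (2*x) (2*y) (4*z) (4*z') ltac:(lia).
rewrite /coarse; set s := P _ _ _; set t := Q _ _ _.
have [_ [E1 [E2 [E3 [E4 E5]]]]] := setcE x s.
have [_ [F1 [F2 [F3 [F4 F5]]]]] := setcE y t.
by rewrite /level /below E1 E2 E3 E4 E5 F1 F2 F3 F4 F5.
Qed.

(** * The shift of finite type *)

Definition gX : H3 := (1, 0, 0).
Definition gY : H3 := (0, 1, 0).
Definition gZ : H3 := (0, 0, 1).

Definition ruleX (t u : tile) : Prop := sc u.1 = 1 - sc t.1 /\ stepT t.2 u.2.
Definition ruleY (t u : tile) : Prop := stepT t.1 u.1 /\ sc u.2 = 1 - sc t.2.
Definition ruleZ (t u : tile) : Prop := stepZ t.1 u.1 /\ stepZ t.2 u.2.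

Definition Omega : cset tile := fun w => forall g,
  cross 1 (w g).1 (w g).2 /\ ruleX (w g) (w (h3_mul gX g)) /\
  ruleY (w g) (w (h3_mul gY g)) /\ ruleZ (w g) (w (h3_mul gZ g)).

Definition lineA (w : config tile) : line := fun x y z => (w (x, y, z)).1.
(** Left multiplication by [gX] fixes [z - x * y]; this coordinate straightens the second family. *)
Definition lineB (w : config tile) : line := fun y x z => (w (x, y, z + x * y)).2.

Lemma h3_mulE x y z a b c :
  h3_mul (x, y, z) (a, b, c) = (x + a, y + b, z + c + x * b).
Proof. by []. Qed.

Lemma h3_mulA g h k : h3_mul g (h3_mul h k) = h3_mul (h3_mul g h) k.
Proof.
by case: g => [[? ?] ?]; case: h => [[? ?] ?]; case: k => [[? ?] ?];
  rewrite !h3_mulE; congr (_, _, _); lia.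
Qed.

Definition h3_inv (g : H3) : H3 := let '(x, y, z) := g in (- x, - y, x * y - z).

Lemma h3_mulVl g : h3_mul (h3_inv g) g = h3_one.
Proof. by case: g => [[x y] z]; rewrite /h3_inv h3_mulE /h3_one; congr (_, _, _); lia. Qed.

Lemma h3_mul1 g : h3_mul g h3_one = g.
Proof. by case: g => [[x y] z]; rewrite /h3_one h3_mulE; congr (_, _, _); lia. Qed.

Lemma h3_1mul g : h3_mul h3_one g = g.
Proof. by case: g => [[x y] z]; rewrite /h3_one h3_mulE; congr (_, _, _); lia. Qed.

Ltac h3_eq := rewrite ?h3_mulE; congr (_, _, _); lia.

Lemma Omega_shift : shift_invariant Omega.
Proof. by move=> g w Hw h; rewrite /shift -!h3_mulA; apply: Hw. Qed.

Lemma shift_mul (T : Type) (w : config T) a b : shift a (shift b w) = shift (h3_mul a b) w.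
Proof. by apply: functional_extensionality => h; rewrite /shift h3_mulA. Qed.

Lemma Omega_twisted w : Omega w <-> twisted 1 (lineA w) (lineB w).
Proof.
split=> [Hw|[_ [[AS [AZ Ac]] [[BS [BZ Bc]] HC]]] [[x y] z]].
- have WX x y z : ruleX (w (x, y, z)) (w (x + 1, y, z + y)).
    have [_ [H _]] := Hw (x, y, z).
    by have <- : h3_mul gX (x, y, z) = (x + 1, y, z + y) by rewrite /gX; h3_eq.
  have WY x y z : ruleY (w (x, y, z)) (w (x, y + 1, z)).
    have [_ [_ [H _]]] := Hw (x, y, z).
    by have <- : h3_mul gY (x, y, z) = (x, y + 1, z) by rewrite /gY; h3_eq.
  have WZ x y z : ruleZ (w (x, y, z)) (w (x, y, z + 1)).
    have [_ [_ [_ H]]] := Hw (x, y, z).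
    by have <- : h3_mul gZ (x, y, z) = (x, y, z + 1) by rewrite /gZ; h3_eq.
  (* [half] compares parities at equal [z], whereas [ruleX] moves [z]; constancy of [c] along
     Z-lines reconciles them. *)
  have CA x y z : sc (w (x, y, z)).1 = sc (w (x, y, 0)).1.
    apply: (@Z_const _ (fun z => sc (w (x, y, z)).1)) => z'.
    by have [[-> _] _] := WZ x y z'.
  have CB x y z : sc (w (x, y, z)).2 = sc (w (x, y, 0)).2.
    apply: (@Z_const _ (fun z => sc (w (x, y, z)).2)) => z'.
    by have [_ [-> _]] := WZ x y z'.
  split; first by left.
  split; [split; [|split]|split; [split; [|split]|]].
  + by move=> x y z y' ->; have [] := WY x y z.
  + by move=> x y z z' ->; have [] := WZ x y z.
  + move=> x y z; rewrite /lineA (CA (x + 1)) -(CA _ _ (z + y)).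
    by have [-> _] := WX x y z.
  + move=> y x z x' ->; rewrite /lineB.
    have -> : z + (x + 1) * y = z + x * y + y by lia.
    by have [] := WX x y (z + x * y).
  + move=> y x z z' ->; rewrite /lineB.
    have -> : z + 1 + x * y = z + x * y + 1 by lia.
    by have [] := WZ x y (z + x * y).
  + move=> y x z; rewrite /lineB CB [in RHS]CB.
    by have [_ ->] := WY x y 0.
  + move=> x y z z' ->; rewrite /lineA /lineB.
    have -> : z - 1 * (x * y) + x * y = z by lia.
    by have [] := Hw (x, y, z).
- have EB x' y' z' : (w (x', y', z')).2 = lineB w y' x' (z' - x' * y').
    by rewrite /lineB; congr (w _).2; congr (_, _); lia.
  split; [|split; [|split]].
  + by rewrite EB; apply: HC; lia.
  + have -> : h3_mul gX (x, y, z) = (x + 1, y, z + y) by rewrite /gX; h3_eq.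
    split.
      have := Ac x y z; have := proj1 (line_const (conj AS (conj AZ Ac)) (x + 1) y z).
      by have := proj1 (line_const (conj AS (conj AZ Ac)) (x + 1) y (z + y)); rewrite /lineA; lia.
    rewrite !EB.
    have -> : z + y - (x + 1) * y = z - x * y by lia.
    by apply: BS.
  + have -> : h3_mul gY (x, y, z) = (x, y + 1, z) by rewrite /gY; h3_eq.
    split; first exact: AS.
    rewrite !EB.
    have K := line_const (conj BS (conj BZ Bc)).
    have := Bc y x 0; have := K (y + 1) x (z - x * (y + 1)); have := K y x (z - x * y).
    have := K (y + 1) x 0; have := K y x 0; lia.
  + have -> : h3_mul gZ (x, y, z) = (x, y, z + 1) by rewrite /gZ; h3_eq.
    split; first exact: AZ.
    by rewrite !EB; apply: BZ; lia.
Qed.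

(** * Desubstitution of configurations *)

Definition dil (g : H3) : H3 := let '(x, y, z) := g in (2 * x, 2 * y, 4 * z).
Lemma dilM g h : dil (h3_mul g h) = h3_mul (dil g) (dil h).
Proof.
by case: g => [[? ?] ?]; case: h => [[? ?] ?]; rewrite /dil !h3_mulE; congr (_, _, _); lia.
Qed.

Definition desub (w : config tile) : config tile := fun g =>
  let '(x, y, z) := g in
  (setc x (w (2 * x, 2 * y, 4 * z)).1, setc y (w (2 * x, 2 * y, 4 * z)).2).

Definition normal_config (w : config tile) : Prop :=
  normal (lineA w) /\ normal (lineB w).

Lemma half_ext P P' : (forall x y z, P' x y z = P x y z) -> half P -> half P'.
Proof.
by move=> E [A [B C]]; split; [|split]; move=> *; rewrite !E; [apply: A|apply: B|apply: C].
Qed.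

Lemma desub_Omega w : Omega w -> normal_config w -> Omega (desub w).
Proof.
move=> /Omega_twisted HT [NA NB]; apply/Omega_twisted.
have EA x y z : lineA (desub w) x y z = coarse (lineA w) x y z by [].
have EB y x z : lineB (desub w) y x z = coarse (lineB w) y x z.
  by rewrite /lineB /coarse /desub; cbn [snd]; congr (setc y (w (_, _, _)).2); lia.
have [He [HP [HQ HC]]] := coarse_twisted HT NA NB.
split=> //; split; first exact: half_ext HP.
split; first exact: half_ext HQ.
by move=> x y z z' E; rewrite EA EB; apply: HC.
Qed.

(** A horizontal translation puts parities and digits right; a central one then sets the common
    central clock of the two planes 1 to zero. *)
Lemma normalize w : Omega w -> exists a, normal_config (shift a w).
Proof.
move=> Hw.
have HT := proj1 (Omega_twisted w) Hw.
have [i [ci ri]] := normal_origin HT.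
have [j [cj rj]] := normal_origin (twisted_sym HT).
set w1 := shift (i, j, 0) w.
have HT1 : twisted 1 (lineA w1) (lineB w1) by apply/Omega_twisted; exact: Omega_shift.
have [_ [HA [HB _]]] := HT.
have KA := line_const HA; have KB := line_const HB.
have A1 x : sc (lineA w1 x 0 0) = sc (lineA w (x + i) 0 0) /\
            sr (lineA w1 x 0 0) = sr (lineA w (x + i) 0 0).
  have -> : lineA w1 x 0 0 = lineA w (x + i) j (x * j).
    by rewrite /w1 /lineA /shift h3_mulE; congr (w (_, _, _)).1; lia.
  by have := KA (x + i) j (x * j); tauto.
have B1 y : sc (lineB w1 y 0 0) = sc (lineB w (y + j) 0 0) /\
            sr (lineB w1 y 0 0) = sr (lineB w (y + j) 0 0).
  have -> : lineB w1 y 0 0 = lineB w (y + j) i (- (i * (y + j))).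
    by rewrite /w1 /lineB /shift h3_mulE; congr (w (_, _, _)).2; lia.
  by have := KB (y + j) i (- (i * (y + j))); tauto.
have E1 : 1 + i = i + 1 by lia. have E2 : 1 + j = j + 1 by lia.
have [a0 _] := A1 0; have [_ a1] := A1 1; have [b0 _] := B1 0; have [_ b1] := B1 1.
rewrite Z.add_0_l ci in a0; rewrite E1 ri in a1; rewrite Z.add_0_l cj in b0; rewrite E2 rj in b1.
set k := sw (lineA w1 1 0 0).
exists (h3_mul (0, 0, - k) (i, j, 0)); rewrite -shift_mul -/w1.
set w2 := shift _ w1.
have HT2 : twisted 1 (lineA w2) (lineB w2) by apply/Omega_twisted; do 2 apply: Omega_shift.
have [_ [HA1 [HB1 _]]] := HT1.
have A2 x z : lineA w2 x 0 z = lineA w1 x 0 (z - k).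
  by rewrite /lineA /w2 /shift h3_mulE; congr (w1 (_, _, _)).1; lia.
have B2 y z : lineB w2 y 0 z = lineB w1 y 0 (z - k).
  by rewrite /lineB /w2 /shift h3_mulE; congr (w1 (_, _, _)).2; lia.
have KA1 := line_const HA1; have KB1 := line_const HB1.
apply: (normal_halves HT2).
- by rewrite A2; have := KA1 0 0 (0 - k); lia.
- by rewrite B2; have := KB1 0 0 (0 - k); lia.
- by rewrite A2; have := KA1 1 0 (0 - k); lia.
- by rewrite B2; have := KB1 1 0 (0 - k); lia.
- rewrite A2.
  have c1 : sc (lineA w1 1 0 0) = 1 by have := proj2 (proj2 HA1) 0 0 0; rewrite Z.add_0_l; lia.
  have [_ [_ [_ HC]]] := HT1.
  have H1 z : sh (lineA w1 1 0 z) = 1.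
    have := HC 1 0 z _ erefl; have := KA1 1 0 z; rewrite /cross /parity; lia.
  have := @Z_const _ (fun z => (sw (lineA w1 1 0 z) - z) mod 4) => K.
  have := K (fun z => ltac:(have := proj1 (proj2 HA1) 1 0 z _ erefl; have := H1 (z + 1); rewrite /stepZ; lia)) (0 - k).
  bnd (lineA w1 1 0 (0 - k)); cbv beta; rewrite -/k; lia.
Qed.

(** * Every admissible tile occurs *)

Lemma lineB_at w x y z : (w (x, y, z)).2 = lineB w y x (z - x * y).
Proof. by rewrite /lineB; congr (w _).2; congr (_, _); lia. Qed.

Lemma desub_lineB w x y z : (desub w (x, y, z)).2 = coarse (lineB w) y x (z - x * y).
Proof. by rewrite /desub /coarse /lineB; cbn [snd]; congr (setc y (w (_, _, _)).2); lia. Qed.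

Lemma refineA w x y z dy dz : Omega w -> normal_config w -> -1 <= dy <= 1 -> -3 <= dz <= 3 ->
  (w (2 * x, 2 * y + dy, 4 * z + dz)).1 = refine dy dz (desub w (x, y, z)).1.
Proof.
by move=> /Omega_twisted HT [NA NB] Hy Hz; have := refine_coarse x y z HT NA NB Hy Hz.
Qed.

Lemma refineB w x y z z' dx dz : Omega w -> normal_config w -> -1 <= dx <= 1 -> -3 <= dz <= 3 ->
  z' - (2 * x + dx) * (2 * y) = 4 * (z - x * y) + dz ->
  (w (2 * x + dx, 2 * y, z')).2 = refine dx dz (desub w (x, y, z)).2.
Proof.
move=> /Omega_twisted /twisted_sym HT [NA NB] Hx Hz E.
by rewrite lineB_at E desub_lineB (refine_coarse y x _ HT NB NA Hx Hz).
Qed.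

Lemma oddA w x y z : normal_config w -> x mod 2 = 1 ->
  (w (x, y, z)).1 = mk 1 (x / 2) y 1 z 1.
Proof. by move=> [[_ NA] _] Hx; apply: NA. Qed.

Lemma oddB w x y z : normal_config w -> y mod 2 = 1 ->
  (w (x, y, z)).2 = mk 1 (y / 2) x 1 (z - x * y) 1.
Proof. by move=> [_ [_ NB]] Hy; rewrite lineB_at; apply: NB. Qed.

Lemma desub_parity w x y z :
  sc (desub w (x, y, z)).1 = x mod 2 /\ sc (desub w (x, y, z)).2 = y mod 2.
Proof. by rewrite /desub; have [-> _] := setcE x (w (2*x,2*y,4*z)).1; have [-> _] := setcE y (w (2*x,2*y,4*z)).2. Qed.

Lemma mk_eq c r q f w h c' r' q' f' w' h' : c mod 2 = c' mod 2 -> r mod 2 = r' mod 2 ->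
  q mod 4 = q' mod 4 -> f mod 2 = f' mod 2 -> w mod 4 = w' mod 4 -> h mod 2 = h' mod 2 ->
  mk c r q f w h = mk c' r' q' f' w' h'.
Proof.
have := mkE c r q f w h; have := mkE c' r' q' f' w' h'.
move=> [E1 [E2 [E3 [E4 [E5 E6]]]]] [F1 [F2 [F3 [F4 [F5 F6]]]]] *.
apply: side_ext; congruence.
Qed.

Lemma refine_mk dy dz c r q f w h : -1 <= dy <= 1 -> -3 <= dz <= 3 ->
  refine dy dz (mk c r q f w h) =
  mk 0 r (if dy <? 0 then q - f mod 2 else q) (if dy =? 0 then f else 0)
     (if dz <? 0 then w - h mod 2 else w) (if dz =? 0 then h else 0).
Proof.
move=> Hy Hz; rewrite /refine.
have [E1 [-> [-> [-> [-> ->]]]]] := mkE c r q f w h.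
by apply: mk_eq; try case: (dy <? 0); try case: (dy =? 0); try case: (dz <? 0);
  try case: (dz =? 0); lia.
Qed.


Lemma oddA_occurs w r q k : Omega w -> exists x y z, (w (x, y, z)).1 = mk 1 r q 1 k 1.
Proof.
move=> Hw; have [a N] := normalize Hw.
case E: (h3_mul (1 + 2 * r, q, k) a) => [[x y] z]; exists x, y, z.
rewrite -E -/(shift a w (1 + 2 * r, q, k)) oddA //; last lia.
by apply: mk_eq; lia.
Qed.

Lemma oddB_occurs w r q k : Omega w -> exists x y z, (w (x, y, z)).2 = mk 1 r q 1 k 1.
Proof.
move=> Hw; have [a N] := normalize Hw.
set p := (q, 1 + 2 * r, k + q * (1 + 2 * r)).
case E: (h3_mul p a) => [[x y] z]; exists x, y, z.
rewrite -E -/(shift a w p) oddB //; last lia.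
by apply: mk_eq; lia.
Qed.

(** Refine a coarse odd plane, where both flags are set: offset [c] in [y] clears [f] when [c = 1],
    offset [1 - h] in [z] clears [h] when [h = 0]. *)
Lemma evenA_occurs w c r q k h : Omega w -> c = 0 \/ c = 1 -> h = 0 \/ h = 1 -> exists x y z,
  (w (x, y, z)).1 = mk 0 r q (1 - c) k h /\ sc (w (x, y, z)).2 = c.
Proof.
move=> Hw Hc Hh; have [a N] := normalize Hw.
have Hw1 : Omega (shift a w) by exact: Omega_shift.
have [x [y [z E]]] := oddA_occurs r q k (desub_Omega Hw1 N).
set p := (2 * x, 2 * y + c, 4 * z + (1 - h)).
case Ep: (h3_mul p a) => [[x' y'] z']; exists x', y', z'.
rewrite -Ep -/(shift a w p) refineA //; try lia.
rewrite E refine_mk; try lia; split.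
  by case: Hc => ->; case: Hh => ->; apply: mk_eq.
by rewrite lineB_at (proj1 (proj2 N)); lia.
Qed.

Lemma evenB_occurs w c r q k h : Omega w -> c = 0 \/ c = 1 -> h = 0 \/ h = 1 -> exists x y z,
  (w (x, y, z)).2 = mk 0 r q (1 - c) k h /\ sc (w (x, y, z)).1 = c.
Proof.
move=> Hw Hc Hh; have [a N] := normalize Hw.
have Hw1 : Omega (shift a w) by exact: Omega_shift.
have [x [y [z E]]] := oddB_occurs r q k (desub_Omega Hw1 N).
set p := (2 * x + c, 2 * y, 4 * (z - x * y) + (1 - h) + (2 * x + c) * (2 * y)).
case Ep: (h3_mul p a) => [[x' y'] z']; exists x', y', z'.
rewrite -Ep -/(shift a w p) (@refineB _ x y z _ c (1 - h)) //; try lia.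
rewrite E refine_mk; try lia; split.
  by case: Hc => ->; case: Hh => ->; apply: mk_eq.
by have -> := proj1 (proj1 N) (2 * x + c) (2 * y) (4 * (z - x * y) + (1 - h) + (2 * x + c) * (2 * y)); lia.
Qed.

Definition tile_in (w : config tile) (t : tile) : Prop := exists g, w g = t.

(** By [level], the clocks [q] encode the digits of both planes, so the clock values themselves
    serve as the position. *)
Lemma odd_odd_occurs w s t : Omega w -> cross 1 s t -> sc s = 1 -> sc t = 1 -> tile_in w (s, t).
Proof.
move=> Hw C Cs Ct; have [a N] := normalize Hw.
exists (h3_mul (sq t, sq s, sw s) a); rewrite -/(shift a w (sq t, sq s, sw s)).
have : level 1 s t by case: C; rewrite /parity /level /below; bnd s; bnd t; lia.
move: C; rewrite /cross /parity /level => C L.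
rewrite [LHS]surjective_pairing oddA // ?oddB //; try lia.
bnd s; bnd t; rewrite [in RHS](side_mk s) [in RHS](side_mk t).
congr (_, _); apply: mk_eq; lia.
Qed.

(** The side [t] is read one step off a coarse vertex, at [2 * x + 1]. If [sq s = 2] the coarse
    plane is odd; if [sq s = 0] it is even and [evenB_occurs] prescribes the parity of [x]. *)
Lemma odd_even_occurs w s t : Omega w -> cross 1 s t -> sc s = 1 -> sc t = 0 -> tile_in w (s, t).
Proof.
move=> Hw C Cs Ct; have [a N] := normalize Hw.
have Hw1 : Omega (shift a w) by exact: Omega_shift.
have Hd := desub_Omega Hw1 N.
bnd s; bnd t.
have [Sf [Sh [Tf Bl]]] : sf s = 1 /\ sh s = 1 /\ sf t = 0 /\
    ((sq s = 2 /\ sq t mod 2 = sr s /\ (sh t = 1 <-> sw s = 2)) \/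
     (sq s = 0 /\ (sh t = 1 -> sw s = 0))).
  by move: C; rewrite /cross /parity /level /below; lia.
have [dz [x [y [z [h [c [f [Hdz [E [Hx [Hy [Hh Hk]]]]]]]]]]]] : exists dz x y z h c f, 0 <= dz <= 3 /\
   (desub (shift a w) (x, y, z)).2 = mk c (sr t) (sq t) f (sw t) h /\
   x mod 2 = sr s /\ (2 * y) mod 4 = sq s /\ (if dz =? 0 then h else 0) = sh t /\
   (dz + 2 * y) mod 4 = sw s.
  case: Bl => [[S2 [T2 H2]]|[S0 H0]].
  - have [x [y [z E]]] := oddB_occurs (sr t) (sq t) (sw t) Hd.
    have [E1 [E2 [E3 [E4 [E5 E6]]]]] := mkE 1 (sr t) (sq t) 1 (sw t) 1.
    have [Dx Dy] := desub_parity (shift a w) x y z.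
    have Cd := proj1 (Hd (x, y, z)).
    rewrite E in Dy Cd.
    exists ((sw s - 2) mod 4), x, y, z, 1, 1, 1.
    (* The clock of a coarse odd plane is odd where it meets an odd plane and even where it meets a
       higher one, so [sq t] gives the parity of [x]. *)
    have Px : x mod 2 = sr s.
      bnd (desub (shift a w) (x, y, z)).1.
      move: Cd; rewrite /cross /parity /level /below E1 E2 E3 E4 E6; lia.
    split; first lia.
    split=> //; split=> //; split; first lia.
    by split; last lia; case: Z.eqb_spec; lia.
  - have [x [y [z [E Dx']]]] := @evenB_occurs _ (sr s) (sr t) (sq t) (sw t) (sh t) Hd ltac:(lia) ltac:(lia).
    have [E1 _] := mkE 0 (sr t) (sq t) (1 - sr s) (sw t) (sh t).
    have [Dx Dy] := desub_parity (shift a w) x y z.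
    rewrite E E1 in Dy.
    exists (sw s), x, y, z, (sh t), 0, (1 - sr s).
    split; first lia.
    split=> //; split; first lia; split; first lia.
    by split; last lia; case: Z.eqb_spec; lia.
(* The last term restores the shear; modulo 4 the height is [dz + 2 * y], as [sw s] requires. *)
set p := (2 * x + 1, 2 * y, 4 * (z - x * y) + dz + (2 * x + 1) * (2 * y)).
exists (h3_mul p a); rewrite -/(shift a w p) [LHS]surjective_pairing.
rewrite oddA //; last lia.
rewrite (@refineB _ x y z _ 1 dz) //; try lia.
rewrite E refine_mk //; try lia.
have -> : (dz <? 0) = false by lia.
rewrite Hh [in RHS](side_mk s) [in RHS](side_mk t).
congr (_, _); apply: mk_eq; rewrite ?Cs ?Ct ?Sf ?Tf ?Sh //; lia.
Qed.

(** Mirror image of [odd_even_occurs], with central clock [dz - 2 * x] on the odd side. *)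
Lemma even_odd_occurs w s t : Omega w -> cross 1 s t -> sc s = 0 -> sc t = 1 -> tile_in w (s, t).
Proof.
move=> Hw C Cs Ct; have [a N] := normalize Hw.
have Hw1 : Omega (shift a w) by exact: Omega_shift.
have Hd := desub_Omega Hw1 N.
bnd s; bnd t.
have [Tf [Th [Sf Bl]]] : sf t = 1 /\ sh t = 1 /\ sf s = 0 /\
    ((sq t = 2 /\ sq s mod 2 = sr t /\ (sh s = 1 <-> sw t = 2)) \/
     (sq t = 0 /\ (sh s = 1 -> sw t = 0))).
  by move: C; rewrite /cross /parity /level /below; lia.
have [dz [x [y [z [h [c [f [Hdz [E [Hy [Hx [Hh Hk]]]]]]]]]]]] : exists dz x y z h c f, 0 <= dz <= 3 /\
   (desub (shift a w) (x, y, z)).1 = mk c (sr s) (sq s) f (sw s) h /\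
   y mod 2 = sr t /\ (2 * x) mod 4 = sq t /\ (if dz =? 0 then h else 0) = sh s /\
   (dz - 2 * x) mod 4 = sw t.
  case: Bl => [[S2 [T2 H2]]|[S0 H0]].
  - have [x [y [z E]]] := oddA_occurs (sr s) (sq s) (sw s) Hd.
    have [E1 [E2 [E3 [E4 [E5 E6]]]]] := mkE 1 (sr s) (sq s) 1 (sw s) 1.
    have [Dx Dy] := desub_parity (shift a w) x y z.
    have Cd := proj1 (Hd (x, y, z)).
    rewrite E in Dx Cd.
    exists ((sw t - 2) mod 4), x, y, z, 1, 1, 1.
    have Px : y mod 2 = sr t.
      bnd (desub (shift a w) (x, y, z)).2.
      move: Cd; rewrite /cross /parity /level /below E1 E2 E3 E4 E6; lia.
    split; first lia.
    split=> //; split=> //; split; first lia.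
    by split; last lia; case: Z.eqb_spec; lia.
  - have [x [y [z [E Dx']]]] := @evenA_occurs _ (sr t) (sr s) (sq s) (sw s) (sh s) Hd ltac:(lia) ltac:(lia).
    have [E1 _] := mkE 0 (sr s) (sq s) (1 - sr t) (sw s) (sh s).
    have [Dx Dy] := desub_parity (shift a w) x y z.
    rewrite E E1 in Dx.
    exists (sw t), x, y, z, (sh s), 0, (1 - sr t).
    split; first lia.
    split=> //; split; first lia; split; first lia.
    by split; last lia; case: Z.eqb_spec; lia.
set p := (2 * x, 2 * y + 1, 4 * z + dz).
exists (h3_mul p a); rewrite -/(shift a w p) [LHS]surjective_pairing.
rewrite oddB //; last lia.
rewrite refineA //; try lia.
rewrite E refine_mk //; try lia.
have -> : (dz <? 0) = false by lia.
have -> : 4 * z + dz - 2 * x * (2 * y + 1) = 4 * (z - x * y) + (dz - 2 * x) by lia.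
rewrite Hh [in RHS](side_mk s) [in RHS](side_mk t).
congr (_, _); apply: mk_eq; rewrite ?Cs ?Ct ?Sf ?Tf ?Sh //; lia.
Qed.

Lemma even_even_occurs w s t s' t' dz : Omega w ->
  (forall w', Omega w' -> tile_in w' (s', t')) -> 0 <= dz <= 1 ->
  refine 0 dz s' = s -> refine 0 dz t' = t -> tile_in w (s, t).
Proof.
move=> Hw H Hdz Es Et; have [a N] := normalize Hw.
have Hw1 : Omega (shift a w) by exact: Omega_shift.
have [[[x y] z] E] := H _ (desub_Omega Hw1 N).
set p := (2 * x + 0, 2 * y + 0, 4 * z + dz).
exists (h3_mul p a); rewrite -/(shift a w p) [LHS]surjective_pairing.
have -> : p = (2 * x, 2 * y + 0, 4 * z + dz) by rewrite /p; congr (_, _, _); lia.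
rewrite refineA //; try lia.
have -> : (2 * x, 2 * y + 0, 4 * z + dz) = (2 * x + 0, 2 * y, 4 * z + dz) by congr (_, _, _); lia.
rewrite (@refineB _ x y z _ 0 dz) //; try lia.
by rewrite E Es Et.
Qed.

(** Supplies the central flag of the upper plane in a coarse tile. If [sh s = 1] it stays visible;
    otherwise refinement hides it, and it is chosen to satisfy [below] with the lower flag raised to
    1. *)
Lemma below_lift s t : below s t -> exists h, (h = 0 \/ h = 1) /\
  (sh s = 1 -> h = sh t) /\ (sq s = 2 -> (h = 1 <-> sw s = 2)) /\
  (sq s = 0 -> h = 1 -> sw s = 0).
Proof.
bnd s; bnd t; move=> [Fs [Ft B]].
have [E|E] : sh s = 1 \/ sh s = 0 by lia.
  by exists (sh t); lia.
have [E1|E1] : (sq s = 2 /\ sw s = 2) \/ ~ (sq s = 2 /\ sw s = 2) by lia.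
  by exists 1; lia.
by exists 0; lia.
Qed.

(** An even-even tile is refined from a coarse tile whose lower side (both sides for [level]) is
    made odd with [h = 1]. That tile is admissible with an odd side, so the previous cases apply
    after one desubstitution. *)
Lemma tile_occurs w t : Omega w -> cross 1 t.1 t.2 -> tile_in w t.
Proof.
case: t => s t Hw; cbn [fst snd] => C; bnd s; bnd t.
have [Cs|Cs] : sc s = 1 \/ sc s = 0 by lia.
all: have [Ct|Ct] : sc t = 1 \/ sc t = 0 by lia.
- exact: odd_odd_occurs.
- exact: odd_even_occurs.
- exact: even_odd_occurs.
pose up (c h : Z) (u : side) := mk c (sr u) (sq u) (sf u) (sw u) h.
have upE c h u (Hc : c = 0 \/ c = 1) (Hh : h = 0 \/ h = 1) : sc (up c h u) = c /\ sr (up c h u) = sr u /\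
   sq (up c h u) = sq u /\ sf (up c h u) = sf u /\ sw (up c h u) = sw u /\ sh (up c h u) = h.
  by rewrite /up; have := mkE c (sr u) (sq u) (sf u) (sw u) h; bnd u; lia.
have ref c h dz u : 0 <= dz <= 1 -> (h = 0 \/ h = 1) -> sc u = 0 -> (if dz =? 0 then h else 0) = sh u ->
    refine 0 dz (up c h u) = u.
  move=> Hd Hh Cu Hu; rewrite /up refine_mk; try lia.
  rewrite [RHS](side_mk u) Cu -Hu; have -> : (dz <? 0) = false by lia.
  by [].
have low s1 t1 : sc s1 = 0 -> sc t1 = 0 -> below s1 t1 -> exists h dz,
    0 <= dz <= 1 /\ (refine 0 dz (up 1 1 s1) = s1 /\ refine 0 dz (up 0 h t1) = t1) /\
    (sc (up 1 1 s1) = 1 /\ sc (up 0 h t1) = 0) /\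
    parity (up 1 1 s1) (up 0 h t1) /\ parity (up 0 h t1) (up 1 1 s1) /\
    below (up 1 1 s1) (up 0 h t1).
  move=> Cs1 Ct1 B; have [h [Hh [H1 [H2 H0]]]] := below_lift B.
  have [F1 [F2 [F3 [F4 [F5 F6]]]]] := upE 1 1 s1 (or_intror erefl) (or_intror erefl).
  have [G1 [G2 [G3 [G4 [G5 G6]]]]] := upE 0 h t1 (or_introl erefl) Hh.
  exists h, (1 - sh s1); bnd s1; bnd t1.
  case: B => Fs [Ft B].
  split; first lia.
  split; first by split; apply: ref => //; try lia; case: Z.eqb_spec; lia.
  split=> //.
  rewrite /parity /below F1 F2 F3 F4 F5 F6 G1 G3 G4 G6.
  split; first lia.
  split; first lia.
  do 2 split=> //.
  case: B => [[S2 [T2 _]]|[S0 _]]; [left|right]; lia.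
have [_ [_ [L|[B|B]]]] := C.
- case: (L) => Fs [Ft [Qs [Qt [Hst Wt]]]].
  have [F1 [F2 [F3 [F4 [F5 F6]]]]] := upE 1 1 s (or_intror erefl) (or_intror erefl).
  have [G1 [G2 [G3 [G4 [G5 G6]]]]] := upE 1 1 t (or_intror erefl) (or_intror erefl).
  apply: (@even_even_occurs _ _ _ (up 1 1 s) (up 1 1 t) (1 - sh s)) => //.
  + move=> w' Hw'; apply: odd_odd_occurs => //.
    rewrite /cross /parity /level F1 F2 F3 F4 F5 F6 G1 G2 G3 G4 G5 G6 Fs Ft.
    split; first lia. split; first lia. by left.
  + lia.
  + by apply: ref; try lia; case: Z.eqb_spec; lia.
  + by apply: ref; try lia; case: Z.eqb_spec; lia.
- have [h [dz [Hdz [[Es Et] [[E1 E2] [P1 [P2 B']]]]]]] := low s t Cs Ct B.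
  apply: (even_even_occurs Hw _ Hdz Es Et) => w' Hw'.
  by apply: odd_even_occurs => //; split=> //; split=> //; right; left.
- have [h [dz [Hdz [[Es Et] [[E1 E2] [P1 [P2 B']]]]]]] := low t s Ct Cs B.
  apply: (even_even_occurs Hw _ Hdz Et Es) => w' Hw'.
  by apply: even_odd_occurs => //; split=> //; split=> //; right; right.
Qed.

(** * Aperiodicity and recurrence *)

Lemma setc_eq c c' s : c mod 2 = c' mod 2 -> setc c s = setc c' s.
Proof. by move=> E; apply: mk_eq. Qed.

(** Comparing odd tiles shows that the conjugated period has all coordinates divisible by 4, which
    also preserves coarse parities. Conjugation adds [i * b - j * a] to the centre, so [c] is
    tracked only when [a = b = 0]. *)
Lemma period_halves w a b c : Omega w -> cfg_eq (shift (a, b, c) w) w ->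
  exists w' c', [/\ Omega w', cfg_eq (shift (a / 2, b / 2, c') w') w',
    a mod 2 = 0, b mod 2 = 0 & a = 0 -> b = 0 -> c = 4 * c'].
Proof.
move=> Hw Hp; have [[[i j] k] N] := normalize Hw.
set s := (i, j, k) in N; set w1 := shift s w in N.
have Hw1 : Omega w1 by exact: Omega_shift.
set c1 := c + i * b - j * a.
have Hp1 h : w1 (h3_mul h (a, b, c1)) = w1 h.
  have := Hp (h3_mul h s); rewrite /w1 /shift -!h3_mulA => <-; congr (w (h3_mul h _)).
  by rewrite /s !h3_mulE /c1; congr (_, _, _); lia.
have [Ha [Hb Hc]] : a mod 4 = 0 /\ b mod 4 = 0 /\ c1 mod 4 = 0.
  have := Hp1 (1, 0, 0); rewrite h3_mulE => /(congr1 fst).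
  have Hx := proj1 (proj1 N) (1 + a) (0 + b) (0 + c1 + 1 * b).
  have Hx1 := proj1 (proj1 N) 1 0 0.
  move=> E; rewrite /lineA E Hx1 in Hx.
  rewrite (oddA _ _ N) in E; last lia.
  rewrite (oddA _ _ N) // in E.
  have := mkE 1 ((1 + a) / 2) (0 + b) 1 (0 + c1 + 1 * b) 1; have := mkE 1 (1 / 2) 0 1 0 1.
  rewrite E; lia.
exists (desub w1), (c1 / 4); split; try lia.
- exact: desub_Omega.
- move=> [[x y] z]; rewrite /shift h3_mulE /desub.
  have -> : (2 * (x + a / 2), 2 * (y + b / 2), 4 * (z + c1 / 4 + x * (b / 2))) =
            h3_mul (2 * x, 2 * y, 4 * z) (a, b, c1).
    have -> : a = 2 * (a / 2) by lia.
    have -> : b = 2 * (b / 2) by lia.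
    have -> : c1 = 4 * (c1 / 4) by lia.
    set a' := a / 2; set b' := b / 2; set c' := c1 / 4.
    have -> : 2 * a' / 2 = a' by lia.
    have -> : 2 * b' / 2 = b' by lia.
    have -> : 4 * c' / 4 = c' by lia.
    by rewrite h3_mulE; congr (_, _, _); lia.
  by rewrite Hp1; congr (_, _); apply: setc_eq; lia.
Qed.

(** Two descents: the horizontal part first, then the central part of a purely central period. *)
Lemma Omega_aperiodic : strongly_aperiodic Omega.
Proof.
have AB : forall n : nat, forall w a b c, (Z.abs a + Z.abs b <= Z.of_nat n) -> Omega w ->
    cfg_eq (shift (a, b, c) w) w -> a = 0 /\ b = 0.
  elim=> [|n IH] w a b c Hn Hw Hp; first lia.
  have [w' [c' [Hw' Hp' Ha Hb _]]] := period_halves Hw Hp.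
  have [?|Hm] : (a = 0 /\ b = 0) \/ Z.abs (a / 2) + Z.abs (b / 2) <= Z.of_nat n by lia.
    by [].
  by have := IH w' _ _ c' Hm Hw' Hp'; lia.
have C : forall n : nat, forall w c, (Z.abs c <= Z.of_nat n) -> Omega w ->
    cfg_eq (shift (0, 0, c) w) w -> c = 0.
  elim=> [|n IH] w c Hn Hw Hp; first lia.
  have [w' [c' [Hw' Hp' Ha Hb Hc]]] := period_halves Hw Hp.
  have {}Hc := Hc erefl erefl.
  have [?|Hm] : c = 0 \/ Z.abs c' <= Z.of_nat n by lia.
    by [].
  by have := IH w' _ Hm Hw' Hp'; lia.
move=> w [[a b] c] Hw Hp.
have [a0 b0] := AB (Z.to_nat (Z.abs a + Z.abs b)) w a b c ltac:(lia) Hw Hp.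
rewrite a0 b0 in Hp *.
by rewrite (C (Z.to_nat (Z.abs c)) w c ltac:(lia) Hw Hp).
Qed.

(** * Balls determined by a single tile *)

(* The bound on [z] is the largest one stable under the recursion of [desub_ball];
   it has to exceed half of the spacing [4^k] of the vertices. *)
Definition ball (k : nat) (g : H3) : Prop := let '(x, y, z) := g in
  Z.abs x < 2 ^ Z.of_nat k /\ Z.abs y < 2 ^ Z.of_nat k /\
  3 * Z.abs z + 2 < 2 * 4 ^ Z.of_nat k + 3 * 2 ^ Z.of_nat k.

(** Each side is either odd, hence given by coordinates modulo 4, or refined from a coarse tile in
    the smaller ball. *)
Lemma desub_ball k w w' v v' : Omega w -> normal_config w -> Omega w' -> normal_config w' ->
  (forall h, ball k h -> desub w (h3_mul h v) = desub w' (h3_mul h v')) ->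
  forall h, ball (S k) h -> w (h3_mul h (dil v)) = w' (h3_mul h (dil v')).
Proof.
move=> Hw N Hw' N' H.
have P2 : 2 ^ Z.of_nat (S k) = 2 * 2 ^ Z.of_nat k by rewrite Nat2Z.inj_succ Z.pow_succ_r; lia.
have P4 : 4 ^ Z.of_nat (S k) = 4 * 4 ^ Z.of_nat k by rewrite Nat2Z.inj_succ Z.pow_succ_r; lia.
have L2 : 1 <= 2 ^ Z.of_nat k by have := Z.pow_pos_nonneg 2 (Z.of_nat k); lia.
have L4 : 1 <= 4 ^ Z.of_nat k by have := Z.pow_pos_nonneg 4 (Z.of_nat k); lia.
rewrite /ball P2 P4.
have {}H x y z : Z.abs x < 2 ^ Z.of_nat k -> Z.abs y < 2 ^ Z.of_nat k ->
    3 * Z.abs z + 2 < 2 * 4 ^ Z.of_nat k + 3 * 2 ^ Z.of_nat k ->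
    desub w (h3_mul (x, y, z) v) = desub w' (h3_mul (x, y, z) v').
  by move=> *; apply: H.
move: (2 ^ Z.of_nat k) (4 ^ Z.of_nat k) L2 L4 H => p2 p4 L2 L4 H {P2 P4}.
case: v v' H => [[v1 v2] v3] [[u1 u2] u3] H.
(* Equal coarse tiles have equal parities, so the dilated centres agree modulo 4 and odd sides
   match. *)
have [V1 V2] : v1 mod 2 = u1 mod 2 /\ v2 mod 2 = u2 mod 2.
  have := H 0 0 0 ltac:(lia) ltac:(lia) ltac:(lia); rewrite !h3_mulE !Z.add_0_l !Z.mul_0_l !Z.add_0_r => E.
  have [A1 A2] := desub_parity w v1 v2 v3; have [B1 B2] := desub_parity w' u1 u2 u3.
  by rewrite E in A1 A2; lia.
case=> [[x y] z] [Hx [Hy Hz]]; rewrite /dil !h3_mulE.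
rewrite [LHS]surjective_pairing [RHS]surjective_pairing; congr (_, _).
- have [Ox|Ox] : x mod 2 = 1 \/ x mod 2 = 0 by lia.
    rewrite !oddA //; try lia.
    have [t Et] : exists t, v2 = u2 + 2 * t by exists ((v2 - u2) / 2); lia.
    by apply: mk_eq; try lia.
  (* Truncation towards zero keeps the coarse point in [ball k]; hence offsets of both signs. *)
  set x' := x / 2; set y' := Z.quot y 2; set z' := Z.quot z 4.
  have Ex : x = 2 * x' by lia.
  have Ey : y = 2 * y' + Z.rem y 2 by lia.
  have Ez : z = 4 * z' + Z.rem z 4 by lia.
  have R a b c : (x + 2 * a, y + 2 * b, z + 4 * c + x * (2 * b)) =
    (2 * (x' + a), 2 * (y' + b) + Z.rem y 2, 4 * (z' + c + x' * b) + Z.rem z 4).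
    by rewrite {1}Ey {1}Ez Ex; congr (_, _, _); lia.
  rewrite !R !refineA //; try lia.
  by have := H x' y' z' ltac:(lia) ltac:(lia) ltac:(lia); rewrite !h3_mulE => ->.
- have [Oy|Oy] : y mod 2 = 1 \/ y mod 2 = 0 by lia.
    rewrite !oddB //; try lia.
    have [t Et] : exists t, v2 = u2 + 2 * t by exists ((v2 - u2) / 2); lia.
    have [s Es] : exists s, v1 = u1 + 2 * s by exists ((v1 - u1) / 2); lia.
    by apply: mk_eq; lia.
  set y' := y / 2; set x' := Z.quot x 2; set dx := Z.rem x 2.
  have Ex : x = 2 * x' + dx by lia.
  have Ey : y = 2 * y' by lia.
  have Bd : -1 <= dx <= 1 by rewrite /dx; lia.
  have Bm : Z.abs (2 * dx * y') <= 2 * Z.abs y'.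
    have D : dx = 0 \/ dx = 1 \/ dx = -1 by lia.
    by case: D => [->|[->|->]]; lia.
  (* [m] is the central shear caused by standing [dx] off the coarse vertex. *)
  set m := 2 * dx * y' in Bm.
  set z' := Z.quot (z - m) 4; set dz := Z.rem (z - m) 4.
  have Ez : z = 4 * z' + dz + m by lia.
  have Bz : -3 <= dz <= 3 by lia.
  have Hb := H x' y' z' ltac:(lia) ltac:(lia) ltac:(lia).
  have R a b c : (x + 2 * a, y + 2 * b, z + 4 * c + x * (2 * b)) =
    (2 * (x' + a) + dx, 2 * (y' + b), z + 4 * c + x * (2 * b)).
    by rewrite Ex {1}Ey; congr (_, _, _); lia.
  rewrite !R.
  rewrite (@refineB _ (x' + v1) (y' + v2) (z' + v3 + x' * v2) _ dx dz) //; last first.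
    by rewrite Ez Ex /m; lia.
  rewrite (@refineB _ (x' + u1) (y' + u2) (z' + u3 + x' * u2) _ dx dz) //; last first.
    by rewrite Ez Ex /m; lia.
  by move: Hb; rewrite !h3_mulE => ->.
Qed.

(* [t] is the tile at [v] of the [k]-fold desubstitution of [w], and [g] is the
   position in [w] of the point [v]. *)
Fixpoint vertex (k : nat) (w : config tile) (g : H3) (t : tile) : Prop :=
  match k with
  | O => w g = t
  | S k' => exists a v, [/\ normal_config (shift a w),
      vertex k' (desub (shift a w)) v t & g = h3_mul (dil v) a]
  end.

Lemma vertex_determines k w w' g g' t : Omega w -> Omega w' ->
  vertex k w g t -> vertex k w' g' t ->
  forall h, ball k h -> w (h3_mul h g) = w' (h3_mul h g').
Proof.
elim: k w w' g g' => [|k IH] w w' g g' Hw Hw'.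
  move=> /= Eg Eg' [[x y] z]; rewrite /ball => B.
  have -> : (x, y, z) = h3_one by rewrite /h3_one; congr (_, _, _); lia.
  by rewrite !h3_1mul Eg Eg'.
move=> [a [v [N V ->]]] [a' [v' [N' V' ->]]] h Hh.
have H1 : Omega (shift a w) by exact: Omega_shift.
have H1' : Omega (shift a' w') by exact: Omega_shift.
rewrite !h3_mulA.
apply: (desub_ball H1 N H1' N' _ Hh) => h' Hh'.
exact: (IH _ _ _ _ (desub_Omega H1 N) (desub_Omega H1' N') V V').
Qed.

Lemma vertex_occurs k w t : Omega w -> cross 1 t.1 t.2 -> exists g, vertex k w g t.
Proof.
elim: k w => [|k IH] w Hw Ht; first exact: tile_occurs.
have [a N] := normalize Hw.
have [v V] := IH _ (desub_Omega (Omega_shift a Hw) N) Ht.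
by exists (h3_mul (dil v) a), a, v.
Qed.

(** At depth 0 every point is a vertex, and each [dil] multiplies the spacings by 2, 2 and 4. *)
Lemma vertex_lattice k w : Omega w -> exists g, forall u1 u2 u3, exists t,
  cross 1 t.1 t.2 /\
  vertex k w (h3_mul (2 ^ Z.of_nat k * u1, 2 ^ Z.of_nat k * u2, 4 ^ Z.of_nat k * u3) g) t.
Proof.
elim: k w => [|k IH] w Hw.
  exists h3_one => u1 u2 u3; eexists; split; last by [].
  exact: proj1 (Hw _).
have [a N] := normalize Hw.
have [g Hg] := IH _ (desub_Omega (Omega_shift a Hw) N).
exists (h3_mul (dil g) a) => u1 u2 u3.
have [t [Ct V]] := Hg u1 u2 u3; exists t; split=> //.
eexists a, _; split; [by []|exact: V|].
rewrite dilM -h3_mulA; congr (h3_mul _ _); rewrite /dil.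
rewrite Nat2Z.inj_succ !Z.pow_succ_r; try lia.
by congr (_, _, _); lia.
Qed.

Lemma vertex_covers w n : Omega w -> 0 <= n -> exists k g t,
  [/\ vertex k w g t, cross 1 t.1 t.2 &
   forall x y z, Z.abs x <= n -> Z.abs y <= n -> Z.abs z <= n ->
     ball k (h3_mul (x, y, z) (h3_inv g))].
Proof.
move=> Hw Hn.
(* Then the margin [4^k / 2] left in the bound of [ball] exceeds [3 * n * 2^k] and absorbs the shear
   [x * b2]. *)
have [k Hk] : exists k : nat, 6 * n + 10 < 2 ^ Z.of_nat k.
  exists (Z.to_nat (6 * n + 10)); rewrite Z2Nat.id; last lia.
  by apply: Z.pow_gt_lin_r; lia.
have [[[c1 c2] c3] Hg] := vertex_lattice k Hw.
set p := 2 ^ Z.of_nat k in Hk Hg; set p4 := 4 ^ Z.of_nat k in Hg.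
have E4 : p4 = p * p.
  by rewrite /p4 /p -Z.pow_mul_l.
have Hp4 : p * (6 * n + 10) < p4 by rewrite E4; apply: (proj1 (Z.mul_lt_mono_pos_l p _ _ _)); lia.
(* Adding any [x] with [|x| <= n] to a value in this window stays strictly between [-p] and [p]. *)
have approx c : exists u, - n <= - (p * u + c) < p - n.
  exists ((n - c) / p).
  by have := Z.div_mod (n - c) p ltac:(lia); have := Z.mod_pos_bound (n - c) p ltac:(lia); lia.
have [u1 B1] := approx c1; have [u2 B2] := approx c2.
set b1 := - (p * u1 + c1) in B1; set b2 := - (p * u2 + c2) in B2.
set m := b1 * b2 - c3 - p * u1 * c2.
have [u3 B3] : exists u3, 2 * Z.abs (m - p4 * u3) <= p4.
  exists ((2 * m + p4) / (2 * p4)).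
  have := Z.div_mod (2 * m + p4) (2 * p4) ltac:(lia).
  by have := Z.mod_pos_bound (2 * m + p4) (2 * p4) ltac:(lia); lia.
have [t [Ct V]] := Hg u1 u2 u3.
exists k, (h3_mul (p * u1, p * u2, p4 * u3) (c1, c2, c3)), t; split; [exact: V|by []|] => x y z Hx Hy Hz.
have Hxb : Z.abs (x * b2) <= n * p.
  by rewrite Z.abs_mul; apply: Z.mul_le_mono_nonneg; lia.
rewrite h3_mulE /h3_inv h3_mulE /ball -/p -/p4 -/b1 -/b2.
have -> : z + ((p * u1 + c1) * (p * u2 + c2) - (p4 * u3 + c3 + p * u1 * c2)) + x * b2 =
  z + (m - p4 * u3) + x * b2 by rewrite /m /b1 /b2; lia.
move: (m - p4 * u3) (x * b2) B3 Hxb => M X B3 Hxb.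
by repeat split; lia.
Qed.

(** One vertex tile determines a ball covering [F]; it is admissible, so it is also a vertex tile of
    [w']. *)
Lemma Omega_recurrent w w' F : Omega w -> Omega w' ->
  exists g, agree_on F w (shift g w').
Proof.
move=> Hw Hw'.
have [n [Hn HF]] : exists n, 0 <= n /\ forall x y z, In (x, y, z) F ->
    Z.abs x <= n /\ Z.abs y <= n /\ Z.abs z <= n.
  elim: F => [|[[x y] z] F [n [Hn IH]]]; first by exists 0.
  exists (n + Z.abs x + Z.abs y + Z.abs z); split; first lia.
  by move=> x' y' z' [[<- <- <-]|/IH]; lia.
have [k [g [t [V Ct B]]]] := vertex_covers Hw Hn.
have [g' V'] := vertex_occurs k Hw' Ct.
exists (h3_mul (h3_inv g) g') => [[[x y] z]] /HF [Hx [Hy Hz]].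
have := vertex_determines Hw Hw' V V' (B x y z Hx Hy Hz).
by rewrite /shift -!h3_mulA h3_mulVl h3_mul1.
Qed.

(** * Existence of a configuration *)

Definition subside (y z : Z) (s : side) : side := refine (y mod 2) (z mod 4) s.

(** Binary recursion strips factors 2 from the plane coordinate; the sign is kept apart so that
    floor division gives the digit of a negative odd coordinate. *)
Fixpoint build_pos (sgn : Z) (p : positive) (y z : Z) : side :=
  match p with
  | xO p' => subside y z (build_pos sgn p' (y / 2) (z / 4))
  | _ => mk 1 (sgn * Zpos p / 2) y 1 z 1
  end.

Definition build (s0 : Z -> side) : line := fun x y z =>
  match x with
  | Z0 => s0 y
  | Zpos p => build_pos 1 p y z
  | Zneg p => build_pos (-1) p y z
  end.

(* The planes [x = 0] and [y = 0] have infinite level; they get the labels of a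
   plane [x = 2^l], [y = 2^n] with [l] much larger than [n] and [n] large. *)
Definition zeroA (_ : Z) : side := mk 0 0 0 0 0 0.
Definition zeroB (x : Z) : side := mk 0 0 (if x <? 0 then 3 else 0) (if x =? 0 then 1 else 0) 0 0.

(** Plane 0 is its own coarse plane, so its labels must be fixed by the substitution. *)
Definition zero_line (s0 : Z -> side) : Prop :=
  forall y z, s0 y = subside y z (s0 (y / 2)).

Lemma build_odd s0 x y z : x mod 2 = 1 -> build s0 x y z = mk 1 (x / 2) y 1 z 1.
Proof.
case: x => [|p|p] //; case: p => [p|p|] //; cbn [build build_pos] => H; try lia.
all: apply: mk_eq => //; lia.
Qed.

Lemma build_even s0 x y z : zero_line s0 ->
  build s0 (2 * x) y z = subside y z (build s0 x (y / 2) (z / 4)).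
Proof. by move=> H; case: x => [|p|p] //; apply: H. Qed.

Lemma subsideE y z s : sc (subside y z s) = 0 /\ sr (subside y z s) = sr s /\
  sq (subside y z s) = sq s /\ sf (subside y z s) = (if y mod 2 =? 0 then sf s else 0) /\
  sw (subside y z s) = sw s /\ sh (subside y z s) = (if z mod 4 =? 0 then sh s else 0).
Proof.
rewrite /subside /refine.
have -> : (y mod 2 <? 0) = false by lia.
have -> : (z mod 4 <? 0) = false by lia.
set f := if _ then sf s else _; set h := if _ then sh s else _.
have := mkE 0 (sr s) (sq s) f (sw s) h; bnd s.
have Bf : 0 <= f <= 1 by rewrite /f; case: (_ =? _); lia.
have Bh : 0 <= h <= 1 by rewrite /h; case: (_ =? _); lia.
lia.
Qed.

Lemma zeroA_line : zero_line zeroA.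
Proof.
move=> y z; have [E1 [E2 [E3 [E4 [E5 E6]]]]] := subsideE y z (zeroA (y / 2)).
by apply: side_ext; rewrite ?E1 ?E2 ?E3 ?E4 ?E5 ?E6 //; case: (_ =? _).
Qed.

Lemma zeroB_line : zero_line zeroB.
Proof.
move=> y z; have [E1 [E2 [E3 [E4 [E5 E6]]]]] := subsideE y z (zeroB (y / 2)).
have M x := mkE 0 0 (if x <? 0 then 3 else 0) (if x =? 0 then 1 else 0) 0 0.
have [M1 [M2 [M3 [M4 [M5 M6]]]]] := M y; have [N1 [N2 [N3 [N4 [N5 N6]]]]] := M (y / 2).
rewrite -/(zeroB y) in M1 M2 M3 M4 M5 M6; rewrite -/(zeroB (y / 2)) in N1 N2 N3 N4 N5 N6.
apply: side_ext; rewrite ?E1 ?E2 ?E3 ?E4 ?E5 ?E6 ?M1 ?M2 ?M3 ?M4 ?M5 ?M6 ?N2 ?N3 ?N4 ?N5 ?N6 //.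
- by case: (Z.ltb_spec y 0); case: (Z.ltb_spec (y / 2) 0) => //; lia.
- by case: (Z.eqb_spec y 0); case: (Z.eqb_spec (y / 2) 0); case: (Z.eqb_spec (y mod 2) 0) => //; lia.
- by case: (_ =? _).
Qed.

Lemma abs_even_ind (R : Z -> Prop) : R 0 -> (forall x, x mod 2 = 1 -> R x) ->
  (forall x, R x -> R (2 * x)) -> forall x, R x.
Proof.
move=> R0 R1 R2 x.
have [n Hn] : exists n : nat, Z.abs x <= Z.of_nat n by exists (Z.to_nat (Z.abs x)); lia.
elim: n x Hn => [|n IH] x Hn; first by have -> : x = 0 by lia.
have [E|[E|E]] : x = 0 \/ x mod 2 = 1 \/ x <> 0 /\ x = 2 * (x / 2) by lia.
- by rewrite E.
- exact: R1.
- by rewrite (proj2 E); apply: R2; apply: IH; lia.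
Qed.

Lemma build_half s0 : zero_line s0 -> (forall y, stepT (s0 y) (s0 (y + 1))) ->
  (forall y, stepZ (s0 y) (s0 y)) -> (forall y, sc (s0 y) = 0) -> half (build s0).
Proof.
move=> H0 HT HZ HC.
have Podd x y z : x mod 2 = 1 -> [/\ sc (build s0 x y z) = 1, sr (build s0 x y z) = (x / 2) mod 2,
   sq (build s0 x y z) = y mod 4, sf (build s0 x y z) = 1 & sw (build s0 x y z) = z mod 4 /\ sh (build s0 x y z) = 1].
  move=> Hx; rewrite build_odd //; have := mkE 1 (x / 2) y 1 z 1.
  by move=> [-> [-> [-> [-> [-> ->]]]]].
split; [|split].
- move=> x y z y' ->; elim/abs_even_ind: x y z => [|x Hx|x IH] y z; first exact: HT.
    have [A1 A2 A3 A4 [A5 A6]] := Podd x y z Hx; have [B1 B2 B3 B4 [B5 B6]] := Podd x (y + 1) z Hx.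
    rewrite /stepT; lia.
  rewrite !build_even //.
  (* Either the step ends between coarse positions, where the flag is 0, or it reaches one and the
     coarse step applies. *)
  have [E|E] : (y + 1) / 2 = y / 2 /\ (y + 1) mod 2 = 1 \/ (y + 1) / 2 = y / 2 + 1 /\ (y + 1) mod 2 = 0 by lia.
    case: E => E1 E2; rewrite E1.
    have := subsideE y z (build s0 x (y / 2) (z / 4)); have := subsideE (y + 1) z (build s0 x (y / 2) (z / 4)).
    bnd (build s0 x (y / 2) (z / 4)).
    rewrite E2; rewrite /stepT; case: (z mod 4 =? 0); case: (y mod 2 =? 0); change (1 =? 0) with false; cbv iota; lia.
  case: E => E1 E2; rewrite E1.
  have := IH (y / 2) (z / 4).
  have := subsideE y z (build s0 x (y / 2) (z / 4)); have := subsideE (y + 1) z (build s0 x (y / 2 + 1) (z / 4)).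
  rewrite E2; rewrite /stepT; case: (z mod 4 =? 0); case: (y mod 2 =? 0); change (0 =? 0) with true; cbv iota; lia.
- move=> x y z z' ->; elim/abs_even_ind: x y z => [|x Hx|x IH] y z; first exact: HZ.
    have [A1 A2 A3 A4 [A5 A6]] := Podd x y z Hx; have [B1 B2 B3 B4 [B5 B6]] := Podd x y (z + 1) Hx.
    rewrite /stepZ; lia.
  rewrite !build_even //.
  have [E|E] : (z + 1) / 4 = z / 4 /\ ((z + 1) mod 4 =? 0) = false \/ (z + 1) / 4 = z / 4 + 1 /\ ((z + 1) mod 4 =? 0) = true by lia.
    case: E => E1 E2; rewrite E1.
    have := subsideE y z (build s0 x (y / 2) (z / 4)); have := subsideE y (z + 1) (build s0 x (y / 2) (z / 4)).
    bnd (build s0 x (y / 2) (z / 4)).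
    rewrite E2; rewrite /stepZ; case: (z mod 4 =? 0); case: (y mod 2 =? 0); lia.
  case: E => E1 E2; rewrite E1.
  have := IH (y / 2) (z / 4).
  have := subsideE y z (build s0 x (y / 2) (z / 4)); have := subsideE y (z + 1) (build s0 x (y / 2) (z / 4 + 1)).
  rewrite E2; rewrite /stepZ; case: (z mod 4 =? 0); case: (y mod 2 =? 0); lia.
- have K x y z : sc (build s0 x y z) = x mod 2.
    have [E|E] : x mod 2 = 1 \/ x = 2 * (x / 2) by lia.
      by have [-> _ _ _ _] := Podd x y z E.
    rewrite E build_even //; have := subsideE y z (build s0 (x / 2) (y / 2) (z / 4)); lia.
  by move=> x y z; rewrite !K; lia.
Qed.

(** Two even planes reduce to the crossing with halved coordinates; a crossing with an odd plane is
    arithmetic modulo 4. *)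
Lemma build_cross x y z z' : z' = z - 1 * (x * y) ->
  cross 1 (build zeroA x y z) (build zeroB y x z').
Proof.
have Odd s0 x1 y1 z1 : x1 mod 2 = 1 -> sc (build s0 x1 y1 z1) = 1 /\ sr (build s0 x1 y1 z1) = (x1 / 2) mod 2 /\
   sq (build s0 x1 y1 z1) = y1 mod 4 /\ sf (build s0 x1 y1 z1) = 1 /\ sw (build s0 x1 y1 z1) = z1 mod 4 /\ sh (build s0 x1 y1 z1) = 1.
  by move=> Hx; rewrite build_odd //; apply: mkE.
(* For odd [x1] and even [y1], both [x1 * y1] and its negative are [y1] modulo 4, so one statement
   serves both orientations. *)
have Mixed s0 s1 x1 y1 z1 z1' : zero_line s1 -> x1 mod 2 = 1 -> y1 mod 2 = 0 ->
    z1' mod 4 = (z1 + y1) mod 4 ->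
    let s := build s0 x1 y1 z1 in let t := build s1 y1 x1 z1' in
    [/\ parity s t, parity t s & below s t].
  move=> Hz Hx Hy Ez s t.
  have As := Odd s0 x1 y1 z1 Hx; rewrite -/s in As.
  have Ey : y1 = 2 * (y1 / 2) by lia.
  have Et : t = subside x1 z1' (build s1 (y1 / 2) (x1 / 2) (z1' / 4)) by rewrite /t {1}Ey build_even.
  have At := subsideE x1 z1' (build s1 (y1 / 2) (x1 / 2) (z1' / 4)); rewrite -Et in At.
  have Hx0 : (x1 mod 2 =? 0) = false by lia.
  rewrite Hx0 in At.
  split; [rewrite /parity; lia|rewrite /parity; lia|].
  split; first lia. split; first lia.
  have [E|E] : y1 mod 4 = 2 \/ y1 mod 4 = 0 by lia.
    have O := Odd s1 (y1 / 2) (x1 / 2) (z1' / 4) ltac:(lia).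
    left; split; first lia. split; first lia.
    by move: At; case: (Z.eqb_spec (z1' mod 4) 0); lia.
  right; split; first lia.
  by move: At; case: (Z.eqb_spec (z1' mod 4) 0); lia.
have [n Hn] : exists n : nat, Z.abs x + Z.abs y <= Z.of_nat n by exists (Z.to_nat (Z.abs x + Z.abs y)); lia.
elim: n x y z z' Hn => [|n IH] x y z z' Hn Ez.
  have -> : x = 0 by lia. have -> : y = 0 by lia.
  by rewrite /cross /parity /level /below; cbn; lia.
have [Ex|Ex] : x mod 2 = 1 \/ x mod 2 = 0 by lia.
all: have [Ey|Ey] : y mod 2 = 1 \/ y mod 2 = 0 by lia.
- have As := Odd zeroA x y z Ex; have At := Odd zeroB y x z' Ey.
  have [i Ei] : exists i, x = 4 * i + 1 + 2 * ((x / 2) mod 2) by exists (x / 4); lia.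
  have [j Ej] : exists j, y = 4 * j + 1 + 2 * ((y / 2) mod 2) by exists (y / 4); lia.
  rewrite /cross /parity /level /below.
  split; first lia. split; first lia. left.
  do 5 (split; first lia).
  have [_ [-> [_ [_ [-> _]]]]] := As; have [_ [-> [_ [_ [-> _]]]]] := At.
  rewrite Ez {1}Ei {1}Ej.
  have E : (x / 2) mod 2 = 0 \/ (x / 2) mod 2 = 1 by lia.
  have F : (y / 2) mod 2 = 0 \/ (y / 2) mod 2 = 1 by lia.
  by case: E => ->; case: F => ->; lia.
- have [P1 P2 B] := Mixed zeroA zeroB x y z z' zeroB_line Ex Ey ltac:(lia).
  by split=> //; split=> //; right; left.
- have [P1 P2 B] := Mixed zeroB zeroA y x z' z zeroA_line Ey Ex ltac:(lia).
  by split=> //; split=> //; right; right.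
- have [[E1 E2]|Hm] : (x = 0 /\ y = 0) \/ Z.abs (x / 2) + Z.abs (y / 2) <= Z.of_nat n by lia.
    by rewrite Ez E1 E2; rewrite /cross /parity /level /below; cbn; lia.
  have Fx : x = 2 * (x / 2) by lia. have Fy : y = 2 * (y / 2) by lia.
  have Fz : z' / 4 = z / 4 - 1 * (x / 2 * (y / 2)) /\ z' mod 4 = z mod 4.
    by rewrite Ez {1 3}Fx {1 2}Fy; move: (x / 2) (y / 2) => a b; split; lia.
  case: Fz => Fz Fz4.
  have := IH _ _ _ _ Hm Fz.
  have Ea : build zeroA x y z = subside y z (build zeroA (x / 2) (y / 2) (z / 4)).
    by rewrite {1}Fx build_even //; apply: zeroA_line.
  have Eb : build zeroB y x z' = subside x z' (build zeroB (y / 2) (x / 2) (z' / 4)).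
    by rewrite {1}Fy build_even //; apply: zeroB_line.
  rewrite Ea Eb.
  set s := build zeroA _ _ _; set t := build zeroB _ _ _.
  have [S1 [S2 [S3 [S4 [S5 S6]]]]] := subsideE y z s; have [T1 [T2 [T3 [T4 [T5 T6]]]]] := subsideE x z' t.
  rewrite Ex Ey Fz4 in S4 S6 T4 T6.
  move=> [_ [_ H]].
  rewrite /cross /parity S1 T1.
  split; first lia. split; first lia.
  move: H; rewrite /level /below S2 S3 S4 S5 S6 T2 T3 T4 T5 T6.
  change (0 =? 0) with true; cbv iota.
  case: (z mod 4 =? 0) => // H; clear - H.
  by case: H => [L|[B|B]]; [left|right; left|right; right]; intuition lia.
Qed.

Lemma Omega_nonempty : nonempty Omega.
Proof.
exists (fun g => let '(x, y, z) := g in (build zeroA x y z, build zeroB y x (z - x * y))).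
apply/Omega_twisted.
set w := fun g => _.
have EA x y z : lineA w x y z = build zeroA x y z by [].
have EB y x z : lineB w y x z = build zeroB y x z.
  by rewrite /lineB /w; cbn [snd]; congr build; lia.
split; first by left.
split.
  apply: (half_ext EA); apply: build_half => //; exact: zeroA_line.
split; last by move=> x y z z' E; rewrite EA EB; apply: build_cross.
apply: (half_ext EB); apply: build_half.
- exact: zeroB_line.
- move=> y; rewrite /stepT /zeroB.
  have := mkE 0 0 (if y <? 0 then 3 else 0) (if y =? 0 then 1 else 0) 0 0.
  have := mkE 0 0 (if y + 1 <? 0 then 3 else 0) (if y + 1 =? 0 then 1 else 0) 0 0.
  move=> [-> [-> [-> [-> [-> ->]]]]] [-> [-> [-> [_ [-> ->]]]]].
  by case: (Z.ltb_spec y 0); case: (Z.ltb_spec (y + 1) 0); case: (Z.eqb_spec (y + 1) 0) => //; lia.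
- move=> y; rewrite /stepZ /zeroB.
  by have := mkE 0 0 (if y <? 0 then 3 else 0) (if y =? 0 then 1 else 0) 0 0; lia.
- by move=> y; rewrite /zeroB; have [-> _] := mkE 0 0 (if y <? 0 then 3 else 0) (if y =? 0 then 1 else 0) 0 0.
Qed.

(** * Finite type and closedness *)

Lemma filter_list (T : Type) (P : T -> Prop) (l : list T) :
  exists l', forall x, In x l' <-> In x l /\ ~ P x.
Proof.
elim: l => [|a l [l' H]]; first by exists nil => x; tauto.
have [Pa|Pa] := classic (P a).
- exists l' => x; rewrite H /=; split; first tauto.
  by case=> [[<-|?] ?]; tauto.
- exists (a :: l') => x; rewrite /= H; split; last tauto.
  by case=> [<-|]; tauto.
Qed.

Lemma In_enum (T : finType) (x : T) : In x (enum T).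
Proof.
have : x \in enum T by rewrite mem_enum.
elim: (enum T) => [|a l IH] //; rewrite seq.in_cons => /orP[/eqP ->|/IH]; by [left|right].
Qed.

(** Forbid the finitely many two-cell patterns on the identity and [s] that violate [R]. *)
Lemma pair_rule_patterns (T : finType) (R : T -> T -> Prop) (s : H3) :
  exists Fb, forall w : config T, SFT_of Fb w <-> forall g, R (w g) (w (h3_mul s g)).
Proof.
have [l Hl] := filter_list (fun p : T * T => R p.1 p.2) (list_prod (enum T) (enum T)).
exists (List.map (fun p => [:: (h3_one, p.1); (s, p.2)]) l) => w; split=> [H g|H p].
- apply: NNPP => N.
  apply: (H [:: (h3_one, w g); (s, w (h3_mul s g))]).
    apply/in_map_iff; exists (w g, w (h3_mul s g)); split=> //.
    by apply/Hl; split=> //; apply/in_prod_iff; split; apply: In_enum.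
  exists g => h a [[<- <-]|[[<- <-]|[]]] //.
  by rewrite h3_1mul.
- move=> /in_map_iff [[a b] [<- /Hl [_ N]]] [g Hg]; apply: N => /=.
  rewrite -(Hg s b) /=; last by right; left.
  rewrite -[X in R X](Hg h3_one a); last by left.
  by rewrite h3_1mul.
Qed.

Lemma SFT_of_app (T : Type) (F G : list (pattern T)) w :
  SFT_of (F ++ G)%list w <-> SFT_of F w /\ SFT_of G w.
Proof.
split=> [H|[HF HG] p /in_app_iff [?|?]]; [|exact: HF|exact: HG].
by split=> p Hp; apply: H; apply/in_app_iff; [left|right].
Qed.

Lemma Omega_SFT : is_SFT Omega.
Proof.
have [FX HX] := pair_rule_patterns (fun t u : tile => cross 1 t.1 t.2 /\ ruleX t u) gX.
have [FY HY] := pair_rule_patterns ruleY gY.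
have [FZ HZ] := pair_rule_patterns ruleZ gZ.
exists (FX ++ FY ++ FZ)%list => w; split=> [Hw|].
- apply/SFT_of_app; split; first by apply/HX => g; have [? [? _]] := Hw g.
  by apply/SFT_of_app; split; [apply/HY|apply/HZ] => g; have [_ [_ []]] := Hw g.
- move=> /SFT_of_app [/HX KX /SFT_of_app [/HY KY /HZ KZ]] g.
  by have [? ?] := KX g.
Qed.

Lemma Omega_closed : closed_set Omega.
Proof.
move=> w H g.
have [w' [Hw' E]] := H [:: g; h3_mul gX g; h3_mul gY g; h3_mul gZ g].
rewrite !E; [exact: Hw'|..]; rewrite /=; tauto.
Qed.

Theorem theorem1 :
  exists (A B : finType) (Omega : cset A) (phi : config A -> config B),
    is_SFT Omega /\ subshift Omega /\ strongly_aperiodic Omega /\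
    factor_map_on phi Omega /\
    subshift (img_set phi Omega) /\
    strongly_aperiodic (img_set phi Omega) /\ minimal (img_set phi Omega) /\
    at_most_two_to_one phi Omega /\
    exists D : cset B, dense_in D (img_set phi Omega) /\
      forall y, D y -> unique_preimage phi Omega y.
Proof.
exists (tile : finType), (tile : finType), Omega, id.
have -> : img_set id Omega = Omega.
  apply: functional_extensionality => y; apply: propositional_extensionality.
  split=> [[w [Hw /functional_extensionality <-]] //|Hy]; by exists y.
have SS : subshift Omega.
  by split; [exact: Omega_nonempty|split; [exact: Omega_closed|exact: Omega_shift]].
split; first exact: Omega_SFT.
split=> //; split; first exact: Omega_aperiodic.
split; first by split=> // w F _; exists F.
split=> //; split; first exact: Omega_aperiodic.
split.
  (* Every window of [w] appears in the orbit of [y], so closedness of [Y] captures [w]. *)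
  move=> Y YO [y Hy] Yc Ys w Hw; apply: Yc => F.
  have [g Hg] := Omega_recurrent F Hw (YO y Hy).
  by exists (shift g y); split=> //; apply: Ys.
split.
  move=> y w1 w2 w3 _ _ _ E1 E2 _; left => h.
  exact: etrans (E1 h) (esym (E2 h)).
(* The identity is injective, so [D] can be all of [Omega]. *)
exists Omega; split; first by split=> // w F Hw; exists w.
by move=> y Hy; exists y; split=> //; split.
Qed.
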